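(* All prime numbers ramified in the extension $K/\mathbb{Q}$ are $p_1, p_2$ and $p_3$, each with ramification index $2$.
   Context: Let $p_1,p_2,p_3$ be prime numbers with $p_i \equiv 1 \pmod 4$, Legendre symbols $\left(\frac{p_i}{p_j}\right)=1$ for $i\neq j$, and Rédei triple symbols $[p_i,p_j,p_k]=1$ for $\{i,j,k\}=\{1,2,3\}$. Assume moreover $p_1 \equiv 5 \pmod 8$ and that $k=\mathbb{Q}(\sqrt{p_1})$ has class number $1$. Put $k_{13}=\mathbb{Q}(\sqrt{p_1},\sqrt{p_3})$. Fix a prime $\mathfrak{p}_2$ of $\mathcal{O}_k$ over $p_2$ and integers $x,y,z$ with $x^2-p_1y^2-p_2z^2=0$, $\gcd(x,y,z)=1$, $y\equiv 0 \pmod 2$, $x-y\equiv 1\pmod 4$, and $\alpha = x+y\sqrt{p_1}$ satisfying $(\alpha)=\mathfrak{p}_2^m$ with $m$ odd; put $k_{13}'=\mathbb{Q}(\sqrt{p_1},\sqrt{\alpha})$. Fix $X,Y,Z\in\mathcal{O}_k$ with $X^2-p_3Y^2-\alpha Z^2=0$, $\gcd(X,Y,Z)=1$, and either $(Z,2)=1$ and there is $\lambda\in\mathcal{O}_{k_{13}}$ with $\lambda^2\equiv X+Y\sqrt{p_3} \pmod 4$, or $(Y,2)=1$ and there is $\lambda\in\mathcal{O}_{k_{13}'}$ with $\lambda^2\equiv X+Z\sqrt{\alpha}\pmod 4$. Writing $\overline{X},\overline{Y},\overline{Z},\overline{\alpha}$ for the conjugates under $\sqrt{p_1}\mapsto-\sqrt{p_1}$,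 set $\theta_1=X+Y\sqrt{p_3}$, $\theta_2=X-Y\sqrt{p_3}$, $\theta_3=\overline{X}+\overline{Y}\sqrt{p_3}$, and $\theta_1'=X+Z\sqrt{\alpha}$, $\theta_2'=X-Z\sqrt{\alpha}$, $\theta_3'=\overline{X}+\overline{Z}\sqrt{\overline{\alpha}}$. Define $K=\mathbb{Q}(\sqrt{p_1},\sqrt{p_2},\sqrt{p_3},\sqrt{\theta_1\theta_2},\sqrt{\theta_1\theta_3},\sqrt{\theta_1})$ if $(Z,2)=1$, and $K=\mathbb{Q}(\sqrt{p_1},\sqrt{p_2},\sqrt{p_3},\sqrt{\theta_1'\theta_2'},\sqrt{\theta_1'\theta_3'},\sqrt{\theta_1'})$ if $(Y,2)=1$. (This $K$ is Galois over $\mathbb{Q}$ of degree $64$ with group $N_4(\mathbb{F}_2)$.) *)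

(* Defs.v *)
From mathcomp Require Export all_boot all_order all_algebra all_field.
From mathcomp Require Export boolp classical_sets.
Set Implicit Arguments.
Unset Strict Implicit.
Unset Printing Implicit Defensive.
Import Order.TTheory GRing.Theory Num.Theory.
Local Open Scope classical_set_scope.
Local Open Scope ring_scope.

(* Number fields are subfields of algC, given as sets; ideals of the ring of
   integers of K are also given as subsets of algC. *)

(* Q(s): the smallest subfield of algC containing s. *)
Definition Qadj (s : seq algC) : set algC :=
  [set w | forall S : {pred algC},
     divring_closed S -> {subset s <= S} -> w \in S].

Definition ringint (K : set algC) : set algC := [set w | K w /\ w \in Aint].

Definition is_ideal (K I : set algC) : Prop :=
  [/\ I `<=` ringint K, I 0,
      (forall a b, I a -> I b -> I (a + b)) &
      (forall a b, ringint K a -> I b -> I (a * b))].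

Definition nonzero_ideal (K I : set algC) : Prop :=
  is_ideal K I /\ exists2 a, I a & a != 0.

Definition principal (K : set algC) (a : algC) : set algC :=
  [set a * w | w in ringint K].

Definition idmul (I J : set algC) : set algC :=
  [set w | exists n (a b : 'I_n -> algC),
     [/\ forall i, I (a i), forall i, J (b i) & w = \sum_(i < n) a i * b i]].

Fixpoint idpow (K I : set algC) (n : nat) : set algC :=
  if n is n'.+1 then idmul I (idpow K I n') else ringint K.

(* Nonzero prime ideals only, as usual for "a prime of K". *)
Definition is_prime (K P : set algC) : Prop :=
  [/\ nonzero_ideal K P, ~ P 1 &
      forall a b, ringint K a -> ringint K b -> P (a * b) -> P a \/ P b].

Definition prime_over (K : set algC) (l : nat) (P : set algC) : Prop :=
  is_prime K P /\ P l%:R.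

(* e is the largest exponent with l O_K contained in (i.e. divisible by) P^e;
   meant for P over l. *)
Definition ram_index (K : set algC) (l : nat) (P : set algC) (e : nat) : Prop :=
  idpow K P e l%:R /\ ~ idpow K P e.+1 l%:R.

Definition ramified (K : set algC) (l : nat) : Prop :=
  exists P e, [/\ prime_over K l P, ram_index K l P e & (1 < e)%N].

(* The residue ring O_K / P has exactly n elements. *)
Definition residue_card (K P : set algC) (n : nat) : Prop :=
  exists r : 'I_n -> algC, (forall i, ringint K (r i)) /\
    forall a, ringint K a -> exists! i, P (a - r i).

Definition inertia_degree (K : set algC) (l : nat) (P : set algC) (f : nat) :
  Prop := residue_card K P (l ^ f)%N.

Definition completely_split (K : set algC) (l : nat) : Prop :=
  forall P, prime_over K l P -> ram_index K l P 1 /\ inertia_degree K l P 1.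

Definition ideal_equiv (K I J : set algC) : Prop :=
  exists a b, [/\ ringint K a /\ a != 0, ringint K b /\ b != 0 &
    [set a * w | w in I] = [set b * w | w in J]].

(* There are exactly h classes of nonzero ideals of O_K. *)
Definition class_number (K : set algC) (h : nat) : Prop :=
  exists C : 'I_h -> set algC, (forall i, nonzero_ideal K (C i)) /\
    forall I, nonzero_ideal K I -> exists! i, ideal_equiv K I (C i).

Definition int_dvd (K : set algC) (d w : algC) : Prop :=
  exists2 c, ringint K c & w = d * c.

Definition int_cong (K : set algC) (n a b : algC) : Prop := int_dvd K n (a - b).

(* gcd(s) = 1 in O_K: every common divisor of s is a unit. *)
Definition int_coprime (K : set algC) (s : seq algC) : Prop :=
  forall d, ringint K d -> (forall w, w \in s -> int_dvd K d w) ->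
    int_dvd K d 1.

Definition legendre (a p : nat) : int :=
  if (p %| a)%N then 0
  else if [exists u : 'I_p, (u ^ 2 == a %[mod p])%N] then 1 else -1.

Definition redei_solution (p q : nat) (x y z : int) : Prop :=
  [/\ x ^+ 2 - p%:Z * y ^+ 2 - q%:Z * z ^+ 2 = 0,
      gcdz x (gcdz y z) = 1,
      (y = 0 %[mod 2])%Z & (x - y = 1 %[mod 4])%Z].

Definition redei_elt (p : nat) (x y : int) : algC :=
  x%:~R + y%:~R * sqrtC p%:R.

(* The Redei extension Q(sqrt p, sqrt q, sqrt alpha), dihedral of degree 8. *)
Definition redei_field (p q : nat) (x y : int) : set algC :=
  Qadj [:: sqrtC p%:R; sqrtC q%:R; sqrtC (redei_elt p x y)].

(* [p, q, r] = s. The symbol is 1 if r splits completely in the Redei extension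
   of p and q, and -1 otherwise; it does not depend on the solution (x, y, z)
   used to construct that extension. *)
Definition redei_symbol (p q r : nat) (s : int) : Prop :=
  exists x y z, redei_solution p q x y z /\
    (completely_split (redei_field p q x y) r /\ s = 1 \/
     ~ completely_split (redei_field p q x y) r /\ s = -1).

(* w' is the image of w in Q(sqrt p) under sqrt p |-> - sqrt p. *)
Definition quad_conj (p : nat) (w w' : algC) : Prop :=
  exists a b : rat, w = ratr a + ratr b * sqrtC p%:R /\
                    w' = ratr a - ratr b * sqrtC p%:R.

(* Main.v *)
(** Let [P] be a prime of [K] over [l] and localize [O_K] at [P].  An element [pi]
    of the maximal ideal is a uniformizer of a subfield [F] of [K] if every nonzero
    element of [F] is [pi ^ n] times a local unit.  If [K] itself has the uniformizer
    [pi] and [l = pi ^ e * unit], then [l] lies in [P ^ n] only for [n <= e].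
    Starting from the uniformizer [l] of [Q], the generators of [K] are adjoined one
    square root at a time.  A uniformizer survives the adjunction of [sqrt a] when [a]
    is a square times a local unit ([l] odd) or a local unit congruent to a square
    mod 4 ([l = 2]), and [pi] is replaced by [sqrt pi] when [a = pi].  Hence [K] has
    the uniformizer [l], or [sqrt l] when [l] is one of the three primes.
    For the last generators, [theta1 * theta2] is a square times a unit, and class
    number one turns the coprimality of [X, Y, Z] into the statement that [theta1]
    and [theta2] do not both lie in the maximal ideal; at the primes where a unit
    factor is lost, [e = 2] is already reached and the radicands lie in a subfield
    where [l] is unramified.  Conjugates are taken with an automorphism of [algC]
    mapping [sqrt p1] to [- sqrt p1]. *)

From HB Require Import structures.
Require Import Defs.
From mathcomp Require Import ring zify.
Set Implicit Arguments.
Unset Strict Implicit.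
Unset Printing Implicit Defensive.
Import Order.TTheory GRing.Theory Num.Theory.
Local Open Scope classical_set_scope.
Local Open Scope ring_scope.

(** * Subfields of algC *)

Definition subfield (F : set algC) : Prop :=
  [/\ F 1, forall a b, F a -> F b -> F (a - b) &
      forall a b, F a -> F b -> F (a / b)].

Section Subfield.
Variable F : set algC.
Hypothesis sF : subfield F.

Lemma subfield1 : F 1. Proof. by case: sF. Qed.
Lemma subfieldB a b : F a -> F b -> F (a - b). Proof. by case: sF => _ + _; exact. Qed.
Lemma subfield_div a b : F a -> F b -> F (a / b). Proof. by case: sF => _ _; exact. Qed.
Lemma subfield0 : F 0. Proof. by rewrite -(subrr 1); apply: subfieldB; exact: subfield1. Qed.
Lemma subfieldN a : F a -> F (- a).
Proof. by move=> Fa; rewrite -sub0r; apply: subfieldB => //; exact: subfield0. Qed.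
Lemma subfieldD a b : F a -> F b -> F (a + b).
Proof. by move=> Fa Fb; rewrite -[b]opprK; apply: subfieldB => //; exact: subfieldN. Qed.
Lemma subfieldV a : F a -> F a^-1.
Proof. by move=> Fa; rewrite -[_^-1]mul1r; apply: subfield_div => //; exact: subfield1. Qed.
Lemma subfieldM a b : F a -> F b -> F (a * b).
Proof. by move=> Fa Fb; rewrite -[b]invrK; apply: subfield_div => //; exact: subfieldV. Qed.
Lemma subfieldX a n : F a -> F (a ^+ n).
Proof.
move=> Fa; elim: n => [|n IH]; first by rewrite expr0; exact: subfield1.
by rewrite exprS; exact: subfieldM.
Qed.
Lemma subfield_exprz a (n : int) : F a -> F (a ^ n).
Proof. by case: n => n Fa; [|apply: subfieldV]; exact: subfieldX. Qed.
Lemma subfield_nat n : F n%:R.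
Proof.
elim: n => [|n IH]; first exact: subfield0.
by rewrite -natr1; apply: subfieldD => //; exact: subfield1.
Qed.
Lemma subfield_int (n : int) : F n%:~R.
Proof. by case: n => n; [|apply: subfieldN]; exact: subfield_nat. Qed.
Lemma subfield_rat (q : rat) : F (ratr q).
Proof. by apply: subfield_div; exact: subfield_int. Qed.

End Subfield.

(** [Qadj] quantifies over boolean predicates, so membership in [F] is first made boolean by the
    classical [[< F w >]]. *)
Lemma Qadj_min s F : subfield F -> (forall w, w \in s -> F w) -> Qadj s `<=` F.
Proof.
move=> [F1 FB Fd] sF w /(_ (fun w => `[< F w >])) Hw; apply/asboolP.
apply: Hw => [|a /sF Fa]; last exact/asboolP.
by split=> [|a b /asboolP Fa /asboolP Fb|a b /asboolP Fa /asboolP Fb]; apply/asboolP; auto.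
Qed.

Lemma Qadj_mem s w : w \in s -> Qadj s w.
Proof. by move=> ws S _; exact. Qed.

Lemma Qadj_subfield s : subfield (Qadj s).
Proof.
split=> [S [S1 _ _] _ //|a b Sa Sb S hS sS|a b Sa Sb S hS sS];
  case: (hS) => _ SB Sd; by [apply: SB; [apply: Sa|apply: Sb] | apply: Sd; [apply: Sa|apply: Sb]].
Qed.

Lemma preim_subfield (nu : {rmorphism algC -> algC}) F :
  subfield F -> subfield [set w | F (nu w)].
Proof.
move=> [F1 FB Fd]; split=> /=; first by rewrite rmorph1.
  by move=> a b Fa Fb; rewrite rmorphB; exact: FB.
by move=> a b Fa Fb; rewrite fmorph_div; exact: Fd.
Qed.

Lemma eq_rmorph_subfield (nu mu : {rmorphism algC -> algC}) :
  subfield [set w | nu w = mu w].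
Proof.
split=> [|a b /= ha hb|a b /= ha hb] /=; rewrite ?rmorph1 //.
  by rewrite !rmorphB ha hb.
by rewrite !fmorph_div ha hb.
Qed.

Definition adj (F : set algC) (r : algC) : set algC :=
  [set w | exists a b, [/\ F a, F b & w = a + b * r]].

Lemma sub_adj F r : subfield F -> F `<=` adj F r.
Proof.
by move=> sF a Fa; exists a, 0; split=> //; rewrite ?mul0r ?addr0 //; exact: subfield0.
Qed.

Lemma adj_gen F r : subfield F -> adj F r r.
Proof.
by move=> sF; exists 0, 1; rewrite mul1r add0r; split=> //; [exact: subfield0|exact: subfield1].
Qed.

Lemma adj_min F G r : subfield G -> F `<=` G -> G r -> adj F r `<=` G.
Proof.
move=> sG FG Gr _ [a [b [/FG Fa /FG Fb ->]]].
by apply: subfieldD => //; exact: subfieldM.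
Qed.

Lemma adj_subfield F r : subfield F -> F (r ^+ 2) -> subfield (adj F r).
Proof.
move=> sF Fr; split; first by apply: sub_adj => //; exact: subfield1.
  move=> _ _ [a [b [Fa Fb ->]]] [c [d [Fc Fd ->]]].
  exists (a - c), (b - d); split; [exact: subfieldB|exact: subfieldB|by ring].
have adjM u v : adj F r u -> adj F r v -> adj F r (u * v).
  move=> [a [b [Fa Fb ->]]] [c [d [Fc Fd ->]]].
  exists (a * c + b * d * r ^+ 2), (a * d + b * c).
  split; last by ring.
    by apply: subfieldD => //; apply: subfieldM => //; exact: subfieldM.
  by apply: subfieldD => //; exact: subfieldM.
move=> u v Fu [c [d [Fc Fd ->]]]; apply: adjM => //.
have [->|nz] := eqVneq (c + d * r) 0; first by rewrite invr0; apply: sub_adj => //; exact: subfield0.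
(* Multiplication by the conjugate fails to invert only when [c - d * r] vanishes; then [d = 0] or
   [r = c / d], and [c + d * r] already lies in [F]. *)
have [e|nz'] := eqVneq (c - d * r) 0.
  have [d0|d0] := eqVneq d 0.
    by apply: sub_adj => //; rewrite d0 mul0r addr0; exact: subfieldV.
  have Fr1 : F r.
    have -> : r = c / d by move/eqP: e; rewrite subr_eq0 => /eqP ->; field.
    exact: subfield_div.
  by apply: sub_adj => //; apply: subfieldV => //; apply: subfieldD => //; exact: subfieldM.
pose n := c ^+ 2 - d ^+ 2 * r ^+ 2.
have nE : n = (c + d * r) * (c - d * r) by rewrite /n; ring.
have Fn : F n by apply: subfieldB => //; rewrite -?exprMn ?exprMn; [exact: subfieldX|apply: subfieldM => //; exact: subfieldX].
exists (c / n), (- d / n); split; [exact: subfield_div|by apply: subfield_div => //; exact: subfieldN|].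
by rewrite nE; field; rewrite nz nz'.
Qed.

(** * Algebraic integers and square roots of primes *)

Lemma Aint_integralOver a : a \in Aint -> integralOver (intr : int -> algC) a.
Proof.
have [q [Dp mon_q _]] := minCpolyP a.
rewrite unfold_in => /polyOverP Zp.
have /floorpP[r Dr] : minCpoly a \is a polyOver Num.int by apply/polyOverP.
exists r; last by rewrite -Dr; exact: root_minCpoly.
have : minCpoly a \is monic by exact: minCpoly_monic.
by rewrite Dr; rewrite !monicE lead_coef_map_inj ?rmorph0 // ?(inj_eq (@intr_inj _)) //; [rewrite -[1](rmorph1 intr) (inj_eq (@intr_inj _))|exact: intr_inj].
Qed.

(** Transitivity of integrality, in degree two. It serves for square roots, for [(1 + sqrt p1) / 2],
    and for the integral closedness of the localization. *)
Lemma Aint_quadratic (w s t : algC) : s \in Aint -> t \in Aint -> w ^+ 2 = s * w + t -> w \in Aint.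
Proof.
move=> As At E.
pose p : {poly algC} := 'X^2 - (s *: 'X + t%:P).
have szp : (size (s *: 'X + t%:P)%R < 3)%N.
  apply: leq_ltn_trans (size_polyD _ _) _; rewrite gtn_max.
  rewrite (leq_ltn_trans (size_scale_leq _ _)) ?size_polyX //=.
  by rewrite (leq_ltn_trans (size_polyC_leq1 _)).
have mp : p \is monic.
  by rewrite monicE /p lead_coefDl ?lead_coefXn // size_polyN size_polyXn.
have [] : integralOver (intr : int -> algC) w.
  apply: (integral_root_monic mp).
    by rewrite rootE !hornerE E subrr.
  apply/integral_poly => i.
  rewrite /p !coefE.
  apply: integral_sub; first by exact: integral_nat.
  apply: integral_add; first by apply: integral_mul; [exact: Aint_integralOver|exact: integral_nat].
  case: ifP => _; [exact: Aint_integralOver|exact: integral0].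
move=> q mq rq; apply: root_monic_Aint rq _ _; first exact: monic_map.
by apply/polyOverP => i; rewrite coef_map intr_int.
Qed.

(** A rational algebraic integer is a rational integer [n], and [l * n = 1] is impossible for a
    prime [l]. *)
Lemma inv_prime_notAint l : prime l -> (l%:R : algC)^-1 \notin Aint.
Proof.
move=> pl; apply/negP => A.
have l0 : (l%:R : algC) != 0 by rewrite pnatr_eq0 -lt0n prime_gt0.
have /intrP[n] : (l%:R : algC)^-1 \in Num.int.
  by apply: Cint_rat_Aint A; rewrite rpredV rpred_nat.
move/(congr1 (fun w => l%:R * w)); rewrite divff // => E.
have : (1 : int) = l%:R * n by apply: (@intr_inj algC); rewrite rmorphM /= rmorph_nat rmorph1.
move/(congr1 absz); rewrite abszM => /esym/eqP; rewrite muln_eq1 => /andP[/eqP] /=.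
by rewrite natz absz_nat => l1; move: pl; rewrite l1.
Qed.

(** Otherwise the root is an integer [n], and [n ^+ 2] has even [p]-adic valuation while [p] has
    valuation 1. *)
Lemma sqrtC_prime_irrational p : prime p -> sqrtC p%:R \notin Crat.
Proof.
move=> pp; apply/negP => rat_r.
have A : sqrtC p%:R \in Aint.
  by apply: (@Aint_quadratic _ 0 p%:R); rewrite ?Aint0 ?rpred_nat // sqrtCK mul0r add0r.
have /intrP[n E] := Cint_rat_Aint rat_r A.
have {}E : (p%:R : int) = n ^+ 2.
  by apply: (@intr_inj algC); rewrite rmorph_nat rmorphXn /= -E sqrtCK.
move/(congr1 absz): E; rewrite natz absz_nat abszX => E.
have := congr1 (logn p) E; rewrite lognX (pfactorK 1 pp); lia.
Qed.

(** By irrationality the minimal polynomial of the root over Q is [X^2 - p], which also vanishes at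
    the opposite root. The resulting automorphism of the quadratic field extends to [algC]. *)
Lemma sqrtC_prime_conj p : prime p ->
  exists nu : {rmorphism algC -> algC}, nu (sqrtC p%:R) = - sqrtC p%:R.
Proof.
move=> pp; set r := sqrtC _.
have [Qs [QsC [[|s []] // [Ds]]] gen] := num_field_exists [:: r].
have s2 : s ^+ 2 = p%:R.
  by apply: (fmorph_inj QsC); rewrite rmorphXn rmorph_nat /= Ds sqrtCK.
have s_irr : s \notin 1%VS.
  apply/negP => /vlineP[a sE]; move/negP: (sqrtC_prime_irrational pp); apply.
  by rewrite -/r -Ds sE alg_num_field fmorph_rat Crat_rat.
pose q : {poly Qs} := 'X^2 - (p%:R)%:P.
have szq : size q = 3%N by rewrite /q size_XnsubC.
have q_s : minPoly 1 s %| q.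
  apply: minPoly_dvdp; last by rewrite /root !hornerE s2 subrr.
  by rewrite rpredB ?rpredX ?polyOverX // polyOverC rpred_nat.
have szm : size (minPoly 1 s) = 3%N.
  have le3 : (size (minPoly 1 s) <= 3)%N by rewrite -szq dvdp_leq // -size_poly_eq0 szq.
  apply/eqP; rewrite eqn_leq le3 size_minPoly ltnS.
  rewrite ltn_neqAle andbT.
  by apply: contra s_irr; rewrite eq_sym adjoin_deg_eq1.
pose phi := kHomExtend 1 \1 s (- s).
have hom1: kHom 1 1 (\1%VF : 'End(Qs)) by rewrite kHom1.
have root_ms: root (map_poly \1%VF (minPoly 1 s)) (- s).
  rewrite (@eq_map_poly _ _ _ idfun) => [|a]; last by rewrite /= id_lfunE.
  rewrite map_poly_id // (eqp_root (p := minPoly 1 s) (q := q)).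
    by rewrite /root !hornerE sqrrN s2 subrr.
  by rewrite -dvdp_size_eqp // szm szq.
have phim : monoid_morphism phi.
  by apply/kHom_monoid_morphism; rewrite -gen span_seq1 /= kHomExtendP.
pose phimM := GRing.isMonoidMorphism.Build _ _ phi phim.
pose phiRM : {rmorphism _ -> _} := HB.pack (fun_of_lfun phi) phimM.
have [nu Dnu] := extend_algC_subfield_aut QsC phiRM.
exists nu; rewrite -Ds -Dnu /= /phi (kHomExtend_val hom1) ?rmorphN //.
Qed.

(** * Prime ideals *)

Section Ringint.
Variable K : set algC.
Hypothesis sK : subfield K.

Lemma ringint_nat n : ringint K n%:R.
Proof. by split; [exact: subfield_nat|exact: rpred_nat]. Qed.
Lemma ringint1 : ringint K 1. Proof. exact: (ringint_nat 1). Qed.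
Lemma ringint0 : ringint K 0. Proof. exact: (ringint_nat 0). Qed.
Lemma ringintD a b : ringint K a -> ringint K b -> ringint K (a + b).
Proof. by move=> [Ka Aa] [Kb Ab]; split; [exact: subfieldD|rewrite rpredD]. Qed.
Lemma ringintM a b : ringint K a -> ringint K b -> ringint K (a * b).
Proof. by move=> [Ka Aa] [Kb Ab]; split; [exact: subfieldM|rewrite rpredM]. Qed.
Lemma ringintN a : ringint K a -> ringint K (- a).
Proof. by move=> [Ka Aa]; split; [exact: subfieldN|rewrite rpredN]. Qed.

(** The ideal generated by [l] is proper because [1 / l] is not integral; Zorn's lemma then gives a
    maximal proper ideal above it, which is prime. *)
Lemma prime_over_exists l : prime l -> exists P, prime_over K l P.
Proof.
move=> pl.
pose D : set (set algC) := [set I | [/\ I `<=` ringint K, ~ I 1,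
  forall a b, I a -> I b -> I (a + b) & forall a b, ringint K a -> I b -> I (a * b)]].
pose L := [set l%:R * w | w in ringint K].
have LD a b : L a -> L b -> L (a + b).
  by move=> [w Kw <-] [v Kv <-]; exists (w + v); rewrite ?mulrDr //; exact: ringintD.
have LM a b : ringint K a -> L b -> L (a * b).
  by move=> Ka [w Kw <-]; exists (a * w); [exact: ringintM|rewrite mulrCA].
have L0 : L 0 by exists 0; [exact: ringint0|rewrite mulr0].
have Ll : L l%:R by exists 1; [exact: ringint1|rewrite mulr1].
have DL : D L.
  split=> //.
    by move=> _ [w Kw <-]; apply: ringintM => //; exact: ringint_nat.
  move=> [w [_ Aw] lw]; move/negP: (inv_prime_notAint pl); apply.
  have l0 : (l%:R : algC) != 0 by rewrite pnatr_eq0 -lt0n prime_gt0.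
  by rewrite -[_^-1]mulr1 -[X in _ * X]lw mulKf.
have [A [[A0|[DA LA]] maxA]] : exists A, [set I | I = set0 \/ D I /\ L `<=` I] A /\
    forall B, A `<` B -> ~ [set I | I = set0 \/ D I /\ L `<=` I] B.
  apply: Zorn_bigcup => F FP totF.
  have [[I0 [FI0 nI0]]|none] := pselect (exists I, F I /\ I != set0); last first.
    left; rewrite -subset0 => a [I FI Ia]; apply: none; exists I; split=> //.
    by apply/set0P; exists a.
  have FI I a : F I -> I a -> D I /\ L `<=` I.
    by move=> /FP [->|//].
  right; split; last first.
    move=> a La; exists I0 => //; case: (FP _ FI0) => [I00|[_ LI]]; last exact: LI.
    by move: nI0; rewrite I00 eqxx.
  split.
  - by move=> a [I FI1 Ia]; case: (FI _ _ FI1 Ia) => -[IK _ _ _] _; exact: IK.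
  - by move=> [I FI1 I1]; case: (FI _ _ FI1 I1) => -[_ + _ _] _; exact.
  - move=> a b [I FI1 Ia] [J FJ1 Jb].
    have [IJ|JI] := totF _ _ FI1 FJ1.
      by case: (FI _ _ FJ1 Jb) => -[_ _ JD _] _; exists J => //; exact: JD (IJ _ Ia) Jb.
    by case: (FI _ _ FI1 Ia) => -[_ _ ID _] _; exists I => //; exact: ID Ia (JI _ Jb).
  - move=> a b Ka [I FI1 Ib]; exists I => //.
    by case: (FI _ _ FI1 Ib) => -[_ _ _ +] _; exact.
- exfalso; apply: (maxA L); last by right; split.
  by rewrite A0; split=> [//|/(_ _ L0)].
have [AK A1 AD AM] := DA; have A0 : A 0 by exact: LA.
exists A; split; last exact: LA.
split=> //.
  split; first by split.
  by exists l%:R; [exact: LA|rewrite pnatr_eq0 -lt0n prime_gt0].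
move=> a b Ka Kb Aab; apply: contrapT => /not_orP[nAa nAb].
(* The ideal generated by [A] and [c]; by maximality it contains 1 as soon as [c] is outside [A]. *)
pose J c := [set i + w * c | i in A & w in ringint K].
have J1 c : ringint K c -> ~ A c -> J c 1.
  move=> Kc nAc; apply: contrapT => nJ1; apply: (maxA (J c)).
    split=> [i Ai|sub].
      by exists i => //; exists 0; [exact: ringint0|rewrite mul0r addr0].
    by apply/nAc/sub; exists 0 => //; exists 1; [exact: ringint1|rewrite mul1r add0r].
  rewrite /=; right; split; last by move=> i /LA Ai; exists i => //; exists 0; [exact: ringint0|rewrite mul0r addr0].
  split=> //.
  - by move=> _ [i Ai [w Kw <-]]; apply: ringintD; [exact: AK|exact: ringintM].
  - move=> _ _ [i Ai [w Kw <-]] [j Aj [v Kv <-]].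
    by exists (i + j); [exact: AD|exists (w + v); [exact: ringintD|ring]].
  - move=> d _ Kd [i Ai [w Kw <-]].
    by exists (d * i); [exact: AM|exists (d * w); [exact: ringintM|ring]].
have [i Ai [w Kw Ea]] := J1 _ Ka nAa; have [j Aj [v Kv Eb]] := J1 _ Kb nAb.
apply: A1.
(* Product of [1 = i + w * a] and [1 = j + v * b], arranged so that every term lies in [A]. *)
have -> : 1 = (j + v * b) * i + (w * a) * j + (w * v) * (a * b).
  by rewrite -[LHS]mulr1 -[in X in X * _]Ea -Eb; ring.
have AM1 : A ((j + v * b) * i) by apply: AM => //; rewrite Eb; exact: ringint1.
have AM2 : A (w * a * j) by apply: AM => //; exact: ringintM.
by apply: (AD); [exact: AD|apply: AM => //; exact: ringintM].
Qed.

End Ringint.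

(** * Local rings and uniformizers *)

(** The properties of the localized ring of integers on which the argument rests. [ld_quadratic] is
    integral closedness in [K] for monic quadratics, the form needed for square roots. *)
Record local_domain (K V M : set algC) : Prop := LocalDomain {
  ld_field : subfield K;
  ld_one : V 1;
  ld_subr : forall a b, V a -> V b -> V (a - b);
  ld_mul : forall a b, V a -> V b -> V (a * b);
  ld_max_sub : M `<=` V;
  ld_max0 : M 0;
  ld_max_subr : forall a b, M a -> M b -> M (a - b);
  ld_max_mul : forall a b, V a -> M b -> M (a * b);
  ld_max_proper : ~ M 1;
  ld_inv : forall a, V a -> ~ M a -> V a^-1;
  ld_quadratic : forall w s t, K w -> V s -> V t -> w ^+ 2 = s * w + t -> V w }.

Section LocalDomain.
Variables K V M : set algC.
Hypothesis ld : local_domain K V M.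

Let sK := ld_field ld.

Definition lunit (a : algC) : Prop := V a /\ ~ M a.
Local Notation U := lunit.

Lemma V1 : V 1. Proof. exact: ld_one ld. Qed.
Lemma VB a b : V a -> V b -> V (a - b). Proof. exact: ld_subr ld _ _. Qed.
Lemma VM a b : V a -> V b -> V (a * b). Proof. exact: ld_mul ld _ _. Qed.
Lemma V0 : V 0. Proof. by rewrite -(subrr 1); apply: VB; exact: V1. Qed.
Lemma VN a : V a -> V (- a). Proof. by move=> Va; rewrite -sub0r; apply: VB => //; exact: V0. Qed.
Lemma VD a b : V a -> V b -> V (a + b).
Proof. by move=> Va Vb; rewrite -[b]opprK; apply: VB => //; exact: VN. Qed.
Lemma VX a n : V a -> V (a ^+ n).
Proof. by move=> Va; elim: n => [|n IH]; [exact: V1|rewrite exprS; exact: VM]. Qed.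
Lemma V_nat n : V n%:R.
Proof. by elim: n => [|n IH]; [exact: V0|rewrite -natr1; apply: VD => //; exact: V1]. Qed.
Lemma V_sqr w : K w -> V (w ^+ 2) -> V w.
Proof.
move=> Kw Vw; apply: (ld_quadratic ld Kw V0 Vw).
by rewrite mul0r add0r.
Qed.

Lemma MV a : M a -> V a. Proof. exact: (ld_max_sub ld). Qed.
Lemma M1 : ~ M 1. Proof. exact: ld_max_proper ld. Qed.
Lemma MB a b : M a -> M b -> M (a - b). Proof. exact: ld_max_subr ld _ _. Qed.
Lemma VMM a b : V a -> M b -> M (a * b). Proof. exact: ld_max_mul ld _ _. Qed.
Lemma MVM a b : M a -> V b -> M (a * b). Proof. by move=> Ma Vb; rewrite mulrC; exact: VMM. Qed.
Lemma MN a : M a -> M (- a). Proof. by move=> Ma; rewrite -mulN1r; apply: VMM => //; apply: VN; exact: V1. Qed.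
Lemma MD a b : M a -> M b -> M (a + b).
Proof. by move=> Ma Mb; rewrite -[b]opprK; apply: MB => //; exact: MN. Qed.
Lemma M_mul a b : V a -> V b -> M (a * b) -> M a \/ M b.
Proof.
move=> Va Vb Mab; apply: contrapT => /not_orP[nMa nMb]; apply: nMb.
have a0 : a != 0 by apply: contra_not_neq nMa => ->; exact: ld_max0 ld.
by rewrite -(mulKf a0 b); apply: VMM => //; exact: (ld_inv ld).
Qed.
Lemma M_sqr a : V a -> M (a ^+ 2) -> M a.
Proof. by move=> Va; rewrite expr2 => /(M_mul Va Va)[]. Qed.

Lemma lunit_neq0 a : U a -> a != 0.
Proof. by move=> [Va nMa]; apply: contra_not_neq nMa => ->; exact: ld_max0 ld. Qed.
Lemma lunitV_V a : U a -> V a^-1. Proof. by case=> Va; exact: (ld_inv ld). Qed.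
Lemma lunit1 : U 1. Proof. by split; [exact: V1|exact: M1]. Qed.
Lemma lunitM a b : U a -> U b -> U (a * b).
Proof. by move=> [Va Ma] [Vb Mb]; split; [exact: VM|move/(M_mul Va Vb) => []]. Qed.
Lemma lunitV a : U a -> U a^-1.
Proof.
move=> Ua; split; first exact: lunitV_V.
move=> MaV; apply: M1; rewrite -(divff (lunit_neq0 Ua)); apply: VMM => //.
by case: Ua.
Qed.
Lemma lunit_div a b : U a -> U b -> U (a / b).
Proof. by move=> Ua Ub; apply: lunitM => //; exact: lunitV. Qed.
Lemma lunitN a : U a -> U (- a).
Proof. by move=> [Va Ma]; split; [exact: VN|move/MN; rewrite opprK]. Qed.
Lemma lunitD_max a b : U a -> M b -> U (a + b).
Proof.
move=> [Va Ma] Mb; split; first by apply: VD => //; exact: MV.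
by move=> Mab; apply: Ma; rewrite -(addrK b a); exact: MB.
Qed.
Lemma lunit_or_max a : V a -> U a \/ M a.
Proof. by move=> Va; have [|] := pselect (M a); [right|left]. Qed.
Lemma lunit_factor a b : V a -> V b -> U (a * b) -> U a.
Proof. by move=> Va Vb [_ nM]; split=> // Ma; apply: nM; exact: MVM. Qed.
Lemma lunit_sqrt a : K a -> U (a ^+ 2) -> U a.
Proof.
move=> Ka Ua; have Va : V a by apply: V_sqr => //; case: Ua.
by apply: (lunit_factor Va Va); rewrite -expr2.
Qed.
Lemma lunit_max_factor a b : V a -> U b -> M (a * b) -> M a.
Proof. by move=> Va [Vb nMb] /(M_mul Va Vb)[]. Qed.

(** * Uniformizers and their behaviour under adjunction of a square root *)

Definition uniformizer (F : set algC) (pi : algC) : Prop :=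
  [/\ M pi, pi != 0 & forall a, F a -> a != 0 ->
      exists (n : int) u, U u /\ a = pi ^ n * u].

Lemma V_exprz pi (n : int) : V pi -> 0 <= n -> V (pi ^ n).
Proof. by case: n => // n Vpi _; exact: VX. Qed.
Lemma M_exprz pi (n : int) : M pi -> 0 < n -> M (pi ^ n).
Proof.
case: n => // -[//|n] Mpi _; rewrite -exprnP exprS; apply: MVM => //.
by apply: VX; exact: MV.
Qed.

(** Uniqueness of the valuation: if [i < j], the unit [u] would equal [pi ^ (j - i) * v], which lies
    in [M]. *)
Lemma exprz_unit_inj pi (i j : int) u v : M pi -> pi != 0 -> U u -> U v ->
  pi ^ i * u = pi ^ j * v -> i = j.
Proof.
move=> Mpi pi0; wlog le_ij : i j u v / i <= j.
  move=> H Uu Uv E; case/orP: (le_total i j) => le; first exact: H E.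
  by apply/esym/(H _ _ _ _ le Uv Uu).
move=> Uu Uv E; apply/eqP; rewrite eq_le le_ij /= leNgt; apply/negP => lt_ij.
have Eu : u = pi ^ (j - i) * v.
  apply: (@mulfI _ (pi ^ i)); first by rewrite expfz_neq0.
  by rewrite mulrA -expfzDr // addrCA subrr addr0.
case: Uu => _; apply; rewrite Eu; apply: MVM; last by case: Uv.
by apply: M_exprz => //; rewrite subr_gt0.
Qed.

Lemma uniformizer_dvd F pi a : uniformizer F pi -> F a -> M a ->
  exists2 v, V v & a = pi * v.
Proof.
move=> [Mpi pi0 HF] Fa Ma; have [->|a0] := eqVneq a 0.
  by exists 0; [exact: V0|rewrite mulr0].
have [n [u [Uu Ea]]] := HF _ Fa a0.
have n_gt0 : 0 < n.
  rewrite ltNge; apply/negP => n_le0; case: Uu => _; apply.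
  have -> : u = pi ^ (- n) * a by rewrite Ea mulrA -expfzDr // addNr expr0z mul1r.
  by apply: VMM => //; apply: V_exprz; [exact: MV|rewrite oppr_ge0].
exists (pi ^ (n - 1) * u).
  by apply: VM; [apply: V_exprz; [exact: MV|lia]|case: Uu].
by rewrite Ea mulrA -{2}[pi]expr1z -expfzDr // addrC subrK.
Qed.

Definition dvr_field (F : set algC) (pi : algC) : Prop :=
  [/\ subfield F, F `<=` K & uniformizer F pi].

(** Factoring out the smaller of the two powers of [pi] leaves a pair in [V] with at least one unit.
    A zero entry has no valuation and is treated apart. *)
Lemma common_scaling F pi b c : uniformizer F pi -> F b -> F c ->
  b != 0 \/ c != 0 ->
  exists (k : int) b0 c0,
    [/\ b = pi ^ k * b0, c = pi ^ k * c0, V b0, V c0 & ~ (M b0 /\ M c0)].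
Proof.
move=> [Mpi pi0 HF] Fb Fc nz.
have [b0|b0] := eqVneq b 0.
  have c0 : c != 0 by case: nz => //; rewrite b0 eqxx.
  have [n [u [[Vu nMu] ->]]] := HF _ Fc c0.
  by exists n, 0, u; rewrite mulr0; split=> //; [exact: V0|case].
have [c0|c0] := eqVneq c 0.
  have [n [u [[Vu nMu] ->]]] := HF _ Fb b0.
  by exists n, u, 0; rewrite mulr0; split=> //; [exact: V0|case].
have [i [u [[Vu nMu] ->]]] := HF _ Fb b0.
have [j [v [[Vv nMv] ->]]] := HF _ Fc c0.
have Vp (n : int) : 0 <= n -> V (pi ^ n) by apply: V_exprz; exact: MV.
case/orP: (le_total i j) => le.
  exists i, u, (pi ^ (j - i) * v); split=> //; [|by apply: VM => //; apply: Vp; rewrite subr_ge0|by case].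
  by rewrite mulrA -expfzDr // addrC subrK.
exists j, (pi ^ (i - j) * u), v; split=> //; [|by apply: VM => //; apply: Vp; rewrite subr_ge0|by case].
by rewrite mulrA -expfzDr // addrC subrK.
Qed.

(* The two conjugates [b + c w] and [b + c w'] cannot both lie in the maximal
   ideal once [b, c] are scaled to be coprime, since [w - w' = 2 n r] is a unit;
   so one of them is a unit and their product lies in [F]. *)
Lemma dvr_field_etale F pi r m n : dvr_field F pi -> K r -> F (r ^+ 2) ->
  F m -> F n -> n != 0 -> V (m + n * r) -> V (m - n * r) -> U (2%:R * (n * r)) ->
  dvr_field (adj F r) pi.
Proof.
move=> [sF FK uF] Kr Fr Fm Fn n0; set w := m + n * r; set w' := m - n * r.
move=> Vw Vw' Uww'; split; first exact: adj_subfield.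
  exact: adj_min.
have [Mpi pi0 HF] := uF; split=> // _ [b [c [Fb Fc ->]]] e_neq0.
(* Change of basis from [1, r] to [1, w]: coordinates relative to the integral element [w] are the
   ones to be scaled. *)
pose c1 := c / n; pose b1 := b - c1 * m.
have Fc1 : F c1 by exact: subfield_div.
have Fb1 : F b1 by apply: subfieldB => //; exact: subfieldM.
have eE : b + c * r = b1 + c1 * w by rewrite /b1 /c1 /w; field.
have nz : b1 != 0 \/ c1 != 0.
  have [c10|] := eqVneq c1 0; last by right.
  by left; apply: contra_neq e_neq0 => b10; rewrite eE b10 c10 mul0r addr0.
have [k [b0 [c0 [Eb Ec Vb0 Vc0 nM]]]] := common_scaling uF Fb1 Fc1 nz.
have pk0 : pi ^ k != 0 by rewrite expfz_neq0.
pose e0 := b0 + c0 * w; pose e0' := b0 + c0 * w'.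
have Ee : b + c * r = pi ^ k * e0 by rewrite eE Eb Ec /e0; ring.
have Ve0 : V e0 by apply: VD => //; exact: VM.
have Ve0' : V e0' by apply: VD => //; exact: VM.
have [Ue0|Me0] := lunit_or_max Ve0; first by exists k, e0.
have [Ue0'|Me0'] := lunit_or_max Ve0'; last first.
  exfalso; apply: nM.
  have Mc0 : M c0.
    apply: (lunit_max_factor Vc0 Uww').
    have -> : c0 * (2%:R * (n * r)) = e0 - e0' by rewrite /e0 /e0' /w /w'; ring.
    exact: MB.
  split=> //; have -> : b0 = e0 - c0 * w by rewrite /e0; ring.
  by apply: MB => //; exact: MVM.
have e0'0 := lunit_neq0 Ue0'.
pose N := (b + c * r) * (b1 + c1 * w').
have EN : N = pi ^ k * e0 * (pi ^ k * e0').
  by rewrite /N Ee; congr (_ * _); rewrite Eb Ec /e0'; ring.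
have FN : F N.
  have -> : N = (b1 + c1 * m) ^+ 2 - (c1 * n) ^+ 2 * r ^+ 2.
    by rewrite /N eE /w /w'; ring.
  apply: subfieldB => //.
    by apply: subfieldX => //; apply: subfieldD => //; exact: subfieldM.
  by apply: subfieldM => //; apply: subfieldX => //; exact: subfieldM.
have N0 : N != 0 by rewrite EN -Ee mulf_neq0 // mulf_neq0.
have [j [u [Uu ENu]]] := HF _ FN N0.
exists (j - k), (u / e0'); split; first exact: lunit_div.
rewrite Ee expfzDr //.
apply: (@mulIf _ (pi ^ k * e0')); first by rewrite mulf_neq0.
rewrite -EN ENu -invr_expz; field; by rewrite e0'0 pk0.
Qed.

Definition sq_unit (F : set algC) (a : algC) : Prop :=
  exists c u, [/\ F c, c != 0, U u & a = c ^+ 2 * u].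

Lemma sq_unitM F a b : subfield F -> sq_unit F a -> sq_unit F b -> sq_unit F (a * b).
Proof.
move=> sF [c [u [Fc c0 Uu ->]]] [d [v [Fd d0 Uv ->]]].
exists (c * d), (u * v); split; [exact: subfieldM|exact: mulf_neq0|exact: lunitM|ring].
Qed.

Lemma sq_unit_lunit F a : subfield F -> U a -> sq_unit F a.
Proof.
move=> sF Ua; exists 1, a; split=> //; [exact: subfield1|exact: oner_neq0|].
by rewrite expr1n mul1r.
Qed.

Lemma sq_unit_sub F G a : F `<=` G -> sq_unit F a -> sq_unit G a.
Proof. by move=> FG [c [u [Fc c0 Uu E]]]; exists c, u; split=> //; exact: FG. Qed.

(** Once the square root [r] of the uniformizer is available in [G], a power of the uniformizer is
    the square of a power of [r], so every nonzero element of [F] acquires even valuation. *)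
Lemma sq_unit_uniformizer F G r a : subfield G -> uniformizer F (r ^+ 2) -> G r ->
  F a -> a != 0 -> sq_unit G a.
Proof.
move=> sG [_ r0 HF] Gr Fa a0; have [n [u [Uu Ea]]] := HF _ Fa a0.
exists (r ^ n), u; split=> //.
- exact: subfield_exprz.
- by rewrite expfz_neq0 //; move: r0; rewrite expf_eq0.
- by rewrite Ea !exprnP exprzAC.
Qed.

(** The element [r / c] is a unit, and so is its difference [2 * r / c] with its conjugate, since 2
    is a unit. *)
Lemma dvr_field_tame F pi r : dvr_field F pi -> K r -> F (r ^+ 2) ->
  U 2%:R -> sq_unit F (r ^+ 2) -> dvr_field (adj F r) pi.
Proof.
move=> dF Kr Fr U2 [c [u [Fc c0 Uu Er]]]; have [sF FK uF] := dF.
have Urc : U (c^-1 * r).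
  apply: lunit_sqrt; last by rewrite exprMn Er exprVn mulKf ?expf_neq0.
  by apply: subfieldM => //; apply: FK; exact: subfieldV.
apply: (@dvr_field_etale F pi r 0 c^-1) => //.
- exact: subfield0.
- exact: subfieldV.
- by rewrite invr_neq0.
- by rewrite add0r; case: Urc.
- by rewrite sub0r; apply: VN; case: Urc.
- exact: lunitM.
Qed.

(** The condition that makes half the sum of [l] and a square root of [a] integral. *)
Definition sq_mod4 (F : set algC) (a : algC) : Prop :=
  exists l, [/\ F l, V l & V ((a - l ^+ 2) / 4%:R)].

Lemma sq_mod4M F a b : subfield F -> V b -> sq_mod4 F a -> sq_mod4 F b -> sq_mod4 F (a * b).
Proof.
move=> sF Vb [l [Fl Vl Va4]] [m [Fm Vm Vb4]]; exists (l * m).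
split; [exact: subfieldM|exact: VM|].
have -> : (a * b - (l * m) ^+ 2) / 4%:R =
  (a - l ^+ 2) / 4%:R * b + l ^+ 2 * ((b - m ^+ 2) / 4%:R) by field.
by apply: VD; apply: VM => //; exact: VX.
Qed.

Lemma sq_mod4_sub F G a : F `<=` G -> sq_mod4 F a -> sq_mod4 G a.
Proof. by move=> FG [l [Fl Vl E]]; exists l; split=> //; exact: FG. Qed.

(** As 2 lies in [M], [l ^+ 2] is a unit along with [a]; the difference of the inverses is then
    minus the original difference divided by the unit [a * l ^+ 2]. *)
Lemma sq_mod4V F a : subfield F -> M 2%:R -> U a -> sq_mod4 F a -> sq_mod4 F a^-1.
Proof.
move=> sF M2 Ua [l [Fl Vl Va4]].
have Ul2 : U (l ^+ 2).
  have -> : l ^+ 2 = a + - (2%:R * (2%:R * ((a - l ^+ 2) / 4%:R))) by field.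
  by apply: lunitD_max => //; apply: MN; apply: MVM => //; apply: VM => //; exact: MV.
have Ul : U l by apply: (lunit_factor Vl Vl); rewrite -expr2.
exists l^-1; split; [exact: subfieldV|exact: lunitV_V|].
have a0 := lunit_neq0 Ua; have l0 := lunit_neq0 Ul.
have -> : (a^-1 - l^-1 ^+ 2) / 4%:R = - ((a - l ^+ 2) / 4%:R * (a^-1 * (l ^+ 2)^-1)).
  by field; rewrite l0 a0.
by apply: VN; apply: VM => //; apply: VM; exact: lunitV_V.
Qed.

(** The conjugates [(l + r) / 2] and [(l - r) / 2] are roots of
    [w ^+ 2 = l * w + (r ^+ 2 - l ^+ 2) / 4], hence lie in [V], and their difference is the unit
    [r]. *)
Lemma dvr_field_wild F pi r : dvr_field F pi -> K r -> F (r ^+ 2) ->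
  U (r ^+ 2) -> sq_mod4 F (r ^+ 2) -> dvr_field (adj F r) pi.
Proof.
move=> dF Kr Fr Ur [l [Fl Vl Vr4]]; have [sF FK uF] := dF.
have F2 : F 2%:R^-1 by apply: subfieldV => //; exact: subfield_nat.
have half (s : algC) : s ^+ 2 = r ^+ 2 -> K s -> V (l / 2%:R + 2%:R^-1 * s).
  move=> Es Ks; apply: (@ld_quadratic _ _ _ ld _ l ((r ^+ 2 - l ^+ 2) / 4%:R)) => //.
    apply: subfieldD => //; apply: subfieldM => //; exact: FK.
  by rewrite -Es; field.
apply: (@dvr_field_etale F pi r (l / 2%:R) 2%:R^-1) => //.
- exact: subfieldM.
- by rewrite invr_neq0 // pnatr_eq0.
- exact: half.
- by rewrite -mulrN; apply: half; [rewrite sqrrN|exact: subfieldN].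
- by rewrite mulVKf ?pnatr_eq0 //; exact: lunit_sqrt.
Qed.

(** Measured in powers of [r], elements of [F] have even valuation, so [b] and [c * r] have
    valuations of different parity and their sum has the smaller one. After scaling, this is
    [b0 + c0 * r] with [b0] a unit, or [r * (c0 + r * v)] with [c0] a unit. *)
Lemma dvr_field_ramified F r : dvr_field F (r ^+ 2) -> K r -> F (r ^+ 2) -> dvr_field (adj F r) r.
Proof.
move=> [sF FK uF] Kr Fr; split; [exact: adj_subfield|exact: adj_min|].
have [Mr2 r20 HF] := uF.
have r0 : r != 0 by move: r20; rewrite expf_eq0.
have Vr : V r by apply: V_sqr => //; exact: MV.
have Mr : M r by exact: M_sqr.
split=> // _ [b [c [Fb Fc ->]]] e_neq0.
have nz : b != 0 \/ c != 0.
  have [c0|] := eqVneq c 0; last by right.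
  by left; apply: contra_neq e_neq0 => ->; rewrite c0 mul0r addr0.
have [k [b0 [c0 [Eb Ec Vb0 Vc0 nM]]]] := common_scaling uF Fb Fc nz.
have Er2 : (r ^+ 2) ^ k = r ^ (2 * k) by rewrite exprnP exprz_exp.
have [Ub0|Mb0] := lunit_or_max Vb0.
  exists (2 * k), (b0 + c0 * r); split; first by apply: lunitD_max => //; exact: VMM.
  by rewrite Eb Ec -Er2; ring.
have Uc0 : U c0 by have [//|Mc0] := lunit_or_max Vc0; case: nM.
have Fb0 : F b0.
  have -> : b0 = (r ^+ 2) ^ (- k) * b.
    by rewrite Eb mulrA -expfzDr // addNr expr0z mul1r.
  by apply: subfieldM => //; exact: subfield_exprz.
have [v Vv Ev] := uniformizer_dvd uF Fb0 Mb0.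
exists (2 * k + 1), (c0 + r * v); split; first by apply: lunitD_max => //; exact: MVM.
by rewrite expfzDr // expr1z -Er2 Eb Ec Ev; ring.
Qed.

(** A Bezout relation between [n] and [l] would put 1 in [M]. *)
Lemma lunit_nat l n : prime l -> M l%:R -> ~~ (l %| n)%N -> U n%:R.
Proof.
move=> pl Ml ndvd; split; first exact: V_nat.
move=> Mn; apply: M1.
have n_gt0 : (0 < n)%N by rewrite lt0n; apply: contra ndvd => /eqP ->.
case: (egcdnP l n_gt0) => u v Euv _.
have cop : gcdn n l = 1%N by apply/eqP; rewrite -/(coprime n l) coprime_sym prime_coprime.
move: Euv; rewrite cop => Euv.
have -> : (1 : algC) = u%:R * n%:R - v%:R * l%:R by rewrite -!natrM Euv natrD addrAC subrr add0r.
by apply: MB; apply: VMM => //; exact: V_nat.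
Qed.

Lemma dvr_field_Crat l : prime l -> M l%:R -> dvr_field [set w | w \in Crat] l%:R.
Proof.
move=> pl Ml.
have sQ : subfield [set w | w \in Crat].
  by split=> /= [|a b Qa Qb|a b Qa Qb]; rewrite ?rpred1 ?rpredB ?rpred_div.
have l0 : (l%:R : algC) != 0 by rewrite pnatr_eq0 -lt0n prime_gt0.
split=> //; first by move=> _ /CratP[q ->]; exact: subfield_rat.
split=> //.
have int_case (n : int) : n != 0 -> exists (k : int) u, U u /\ (n%:~R : algC) = l%:R ^ k * u.
  move=> n0; have n_gt0 : (0 < `|n|)%N by rewrite absz_gt0.
  have [m cop En] := pfactor_coprime pl n_gt0.
  exists (logn l `|n|)%:Z, ((-1) ^+ (n < 0)%R * m%:R); split.
    apply: lunitM; first by case: (n < 0)%R; [apply: lunitN|]; exact: lunit1.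
    by apply: (lunit_nat pl) => //; rewrite -prime_coprime.
  rewrite {1}(intEsign n) rmorphM /= rmorph_sign mulrCA; congr (_ * _).
  by rewrite {1}En PoszM rmorphM /= mulrC -!pmulrn natrX exprnP.
move=> _ /CratP[q ->] q0.
have nq : numq q != 0 by rewrite numq_eq0; apply: contra q0 => /eqP ->; rewrite rmorph0.
have [i [u [Uu Eu]]] := int_case _ nq.
have [j [v [Uv Ev]]] := int_case _ (denq_neq0 q).
exists (i - j), (u / v); split; first exact: lunit_div.
rewrite /ratr Eu Ev expfzDr // -invr_expz; field.
by rewrite (lunit_neq0 Uv) expfz_neq0.
Qed.

End LocalDomain.

(** * Localization at a prime and the bound on the ramification index *)

Definition loc (K P : set algC) : set algC :=
  [set w | exists a s, [/\ ringint K a, ringint K s, ~ P s & w = a / s]].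
Definition locmax (K P : set algC) : set algC :=
  [set w | exists a s, [/\ P a, ringint K s, ~ P s & w = a / s]].

Section Localization.
Variables (K P : set algC).
Hypotheses (sK : subfield K) (pP : is_prime K P).

Let PK : P `<=` ringint K. Proof. by case: pP => -[[]]. Qed.
Let P0 : P 0. Proof. by case: pP => -[[]]. Qed.
Let PD a b : P a -> P b -> P (a + b). Proof. by case: pP => -[[_ _ + _ _]] _ _; exact. Qed.
Let PM a b : ringint K a -> P b -> P (a * b). Proof. by case: pP => -[[_ _ _ + _]] _ _; exact. Qed.
Let P1 : ~ P 1. Proof. by case: pP. Qed.
Let Pprime a b : ringint K a -> ringint K b -> P (a * b) -> P a \/ P b.
Proof. by case: pP => _ _; exact. Qed.
Let P_neq0 s : ~ P s -> s != 0. Proof. by apply: contra_not_neq => ->. Qed.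
Let nPM s t : ringint K s -> ringint K t -> ~ P s -> ~ P t -> ~ P (s * t).
Proof. by move=> Ks Kt ns nt /(Pprime Ks Kt)[]. Qed.

Lemma ringint_loc a : ringint K a -> loc K P a.
Proof. by move=> Ka; exists a, 1; rewrite divr1; split=> //; exact: ringint1. Qed.
Lemma prime_locmax a : P a -> locmax K P a.
Proof. by move=> Pa; exists a, 1; rewrite divr1; split=> //; exact: ringint1. Qed.
Lemma locmax_ringint a : ringint K a -> locmax K P a -> P a.
Proof.
move=> Ka [b [s [Pb Ks Ps E]]].
have : P (a * s) by rewrite E divfK // P_neq0.
by move/(Pprime Ka Ks) => [].
Qed.

Lemma loc_local_domain : local_domain K (loc K P) (locmax K P).
Proof.
split=> //.
- by apply: ringint_loc; exact: ringint1.
- move=> _ _ [a [s [Ka Ks Ps ->]]] [b [t [Kb Kt Pt ->]]].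
  exists (a * t + - (b * s)), (s * t); split; [|exact: ringintM|exact: nPM|].
    by apply: ringintD => //; [exact: ringintM|apply: ringintN => //; exact: ringintM].
  by field; rewrite !P_neq0.
- move=> _ _ [a [s [Ka Ks Ps ->]]] [b [t [Kb Kt Pt ->]]].
  exists (a * b), (s * t); split; [exact: ringintM|exact: ringintM|exact: nPM|].
  by field; rewrite !P_neq0.
- by move=> _ [a [s [/PK Ka Ks Ps ->]]]; exists a, s.
- exact: prime_locmax.
- move=> _ _ [a [s [Pa Ks Ps ->]]] [b [t [Pb Kt Pt ->]]].
  exists (t * a + (- s) * b), (s * t); split; [|exact: ringintM|exact: nPM|].
    by apply: PD => //; apply: PM => //; exact: ringintN.
  by field; rewrite !P_neq0.
- move=> _ _ [a [s [Ka Ks Ps ->]]] [b [t [Pb Kt Pt ->]]].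
  exists (a * b), (s * t); split; [exact: PM|exact: ringintM|exact: nPM|].
  by field; rewrite !P_neq0.
- by move/(locmax_ringint (ringint1 sK)).
- move=> _ [a [s [Ka Ks Ps ->]]] nM.
  have Pa : ~ P a by move=> Pa; apply: nM; exists a, s.
  by exists s, a; split=> //; rewrite invf_div.
- move=> w _ _ Kw [a [s [Ka Ks Ps ->]]] [b [t [Kb Kt Pt ->]]] E.
  (* Clearing denominators: [s * t * w] is a root of a monic quadratic with coefficients [a * t] and
     [b * s * (s * t)], so it is an algebraic integer. *)
  exists (s * t * w), (s * t); split; [|exact: ringintM|exact: nPM|].
    split; first by apply: subfieldM => //; case: (ringintM sK Ks Kt).
    apply: (@Aint_quadratic _ (a * t) (b * s * (s * t))).
    + by case: (ringintM sK Ka Kt).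
    + by case: (ringintM sK (ringintM sK Kb Ks) (ringintM sK Ks Kt)).
    + by rewrite exprMn E; field; rewrite !P_neq0.
  by rewrite mulrC mulKf // mulf_neq0 // P_neq0.
Qed.

Let ld := loc_local_domain.

(** Each element of [P] is [pi] times an element of [V], and an element of the [n]-th power is a sum
    of products of [n] such elements with an integer. *)
Lemma idpow_uniformizer pi n w : uniformizer (loc K P) (locmax K P) K pi ->
  idpow K P n w -> exists2 v, loc K P v & w = pi ^+ n * v.
Proof.
move=> uK; elim: n w => [|n IH] w.
  by move=> Kw; exists w; [exact: ringint_loc|rewrite mul1r].
move=> [m [a [b [Pa Pb ->]]]].
elim/big_ind: _ => [|u v [u' Vu ->] [v' Vv ->]|i _].
- by exists 0; [exact: V0 ld|rewrite mulr0].
- by exists (u' + v'); [exact: (VD ld)|rewrite mulrDr].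
- have Ka : K (a i) by case: (PK (Pa i)).
  have [v Vv ->] := uniformizer_dvd ld uK Ka (prime_locmax (Pa i)).
  have [u Vu ->] := IH _ (Pb i).
  by exists (v * u); [exact: (VM ld)|rewrite exprS; ring].
Qed.

(** If [n] exceeded [e], the unit [u] would be divisible by [pi]. *)
Lemma ram_exponent_le pi l e n u : uniformizer (loc K P) (locmax K P) K pi ->
  lunit (loc K P) (locmax K P) u -> l%:R = pi ^+ e * u ->
  idpow K P n l%:R -> (n <= e)%N.
Proof.
move=> uK Uu -> /(idpow_uniformizer uK)[v Vv E].
rewrite leqNgt; apply/negP => lt_en; case: Uu => _; apply.
have [Mpi pi0 _] := uK.
have -> : u = pi * (pi ^+ (n - e).-1 * v).
  apply: (@mulfI _ (pi ^+ e)); first by rewrite expf_neq0.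
  have En : n = (e + (n - e).-1.+1)%N by lia.
  by rewrite E {1}En exprD exprS -!mulrA.
apply: (MVM ld) => //; apply: (VM ld) => //; apply: (VX ld).
exact: (MV ld).
Qed.

End Localization.

(** * Class number one and conjugation *)

Lemma Qadj_sub s t : {subset s <= t} -> Qadj s `<=` Qadj t.
Proof.
by move=> st; apply: Qadj_min; [exact: Qadj_subfield|move=> w /st; exact: Qadj_mem].
Qed.

Lemma Qadj_cons_sub s r : Qadj s (r ^+ 2) -> Qadj (r :: s) `<=` adj (Qadj s) r.
Proof.
move=> sr; have sS := Qadj_subfield s.
apply: Qadj_min; first exact: adj_subfield.
by move=> w; rewrite inE => /orP[/eqP ->|ws]; [exact: adj_gen|apply: sub_adj => //; exact: Qadj_mem].
Qed.

(** The contraction of [P] to [k] is a nonzero ideal, hence principal by class number one. If all of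
    [s] lay in [P], its generator would be a common divisor of [s], thus a unit, and [P] would
    contain 1. *)
Lemma coprime_not_all_in_prime K k P l s : subfield k -> k `<=` K ->
  class_number k 1 -> prime l -> prime_over K l P -> int_coprime k s ->
  (forall w, w \in s -> ringint k w) -> exists2 w, w \in s & ~ P w.
Proof.
move=> sk kK [C [_ uniqC]] pl [[[[PK P0 PD PM] _] P1 _] Pl] cop sk_int.
apply: contrapT => none.
have sP w : w \in s -> P w.
  by move=> ws; apply: contrapT => nPw; apply: none; exists w.
have intK a : ringint k a -> ringint K a by move=> [ka Aa]; split=> //; exact: kK.
pose I : set algC := [set w | P w /\ k w].
have nzI : nonzero_ideal k I.
  split; last first.
    exists l%:R; first by split=> //; exact: subfield_nat.
    by rewrite pnatr_eq0 -lt0n prime_gt0.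
  split.
  - by move=> a [Pa ka]; split=> //; case: (PK _ Pa).
  - by split=> //; exact: subfield0.
  - by move=> a b [Pa ka] [Pb kb]; split; [exact: PD|exact: subfieldD].
  - move=> a b Ka [Pb kb]; split; first by apply: PM => //; exact: intK.
    by apply: subfieldM => //; case: Ka.
have nzO : nonzero_ideal k (ringint k).
  split; last by exists 1; [exact: ringint1|exact: oner_neq0].
  split=> //; [exact: ringint0|by move=> a b; exact: ringintD|by move=> a b; exact: ringintM].
(* Both [I] and the whole ring are equivalent to the single representative [C ord0], whence
   [a * d * I = b * c * O_k]; the generator [i0] satisfies [a * d * i0 = b * c]. *)
have [i [[a [b [[Ka a0] [Kb b0] E1]]] _]] := uniqC _ nzI.
have [j [[c [d [[Kc c0] [Kd d0] E2]]] _]] := uniqC _ nzO.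
rewrite (ord1 i) in E1; rewrite (ord1 j) in E2.
have IO w : I w -> exists2 o, ringint k o & a * d * w = b * c * o.
  move=> Iw; have : [set a * w | w in I] (a * w) by exists w.
  rewrite E1 => -[g Cg Eg]; have : [set d * w | w in C ord0] (d * g) by exists g.
  rewrite -E2 => -[o Ko Eo]; exists o => //.
  by rewrite -[RHS]mulrA Eo [LHS]mulrAC -Eg; ring.
have [i0 Ii0 Ei0] : exists2 i0, I i0 & a * d * i0 = b * c.
  have : [set c * w | w in ringint k] (c * 1) by exists 1 => //; exact: ringint1.
  rewrite E2 => -[g Cg Eg]; have : [set b * w | w in C ord0] (b * g) by exists g.
  rewrite -E1 => -[i0 Ii0 Eo]; exists i0 => //.
  by rewrite [LHS]mulrAC Eo -[c]mulr1 -Eg; ring.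
have i0_dvd w : I w -> int_dvd k i0 w.
  move=> /IO[o Ko Eo]; exists o => //.
  by apply: (@mulfI _ (a * d)); rewrite ?mulf_neq0 // Eo mulrA Ei0.
have [Pi0 ki0] := Ii0.
have Ki0 : ringint k i0 by split=> //; case: (PK _ Pi0).
have [c1 Kc1 E] := cop _ Ki0 (fun w ws => i0_dvd w (conj (sP w ws) (proj1 (sk_int w ws)))).
by apply: P1; rewrite E mulrC; apply: PM => //; exact: intK.
Qed.

(** Otherwise 2, a common divisor of 0 and 2, would be a unit. This excludes the value 0 for the
    coordinate assumed prime to 2. *)
Lemma int_coprime_0_2 k : int_coprime k [:: 0; 2%:R] -> subfield k -> False.
Proof.
move=> cop sk; have K2 := ringint_nat sk 2.
have [|c [_ Ac] E] := cop _ K2.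
  move=> w; rewrite !inE => /orP[] /eqP ->.
    by exists 0; [exact: ringint0|rewrite mulr0].
  by exists 1; [exact: ringint1|rewrite mulr1].
move/negP: (@inv_prime_notAint 2 isT); apply.
by rewrite -[_^-1]mulr1 [X in _ * X]E mulKf ?pnatr_eq0.
Qed.

Section Conjugation.
Variables (p : nat) (nu : {rmorphism algC -> algC}).
Hypothesis nu_r : nu (sqrtC p%:R) = - sqrtC p%:R.
Local Notation k := (Qadj [:: sqrtC p%:R]).

Lemma quad_conjE w w' : quad_conj p w w' -> w' = nu w.
Proof.
move=> [a [b [-> ->]]]; rewrite rmorphD fmorph_rat (rmorphM nu (ratr b)).
by rewrite fmorph_rat nu_r mulrN.
Qed.

Lemma conj_Qadj w : k w -> k (nu w).
Proof.
apply: (@Qadj_min _ [set w | k (nu w)]).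
  by apply: preim_subfield; exact: Qadj_subfield.
move=> r /[!inE] /eqP -> /=; rewrite nu_r.
by apply: (subfieldN (Qadj_subfield _)); apply: Qadj_mem; rewrite inE.
Qed.

Lemma conj_ringint w : ringint k w -> ringint k (nu w).
Proof. by move=> [kw Aw]; split; [exact: conj_Qadj|rewrite Aint_aut]. Qed.

Lemma conjK w : k w -> nu (nu w) = w.
Proof.
apply: (@Qadj_min _ [set w | (nu \o nu) w = idfun w]).
  exact: (eq_rmorph_subfield (nu \o nu) idfun).
by move=> r /[!inE] /eqP -> /=; rewrite nu_r rmorphN nu_r opprK.
Qed.

(** Divisibility is transported by [nu], which preserves the integers of [k] and is an involution on
    [k]. *)
Lemma int_coprime_conj s : (forall w, w \in s -> k w) ->
  int_coprime k s -> int_coprime k (map nu s).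
Proof.
move=> sk cop d Kd dvd.
have dvd_conj e w : int_dvd k e w -> int_dvd k (nu e) (nu w).
  by move=> [c Kc ->]; exists (nu c); [exact: conj_ringint|rewrite rmorphM].
have : int_dvd k (nu d) 1.
  apply: cop; first exact: conj_ringint.
  by move=> w ws; have /dvd_conj := dvd _ (map_f nu ws); rewrite (conjK (sk _ ws)).
by move/dvd_conj; rewrite (conjK (proj1 Kd)) rmorph1.
Qed.

End Conjugation.

(** * Radicands whose square root preserves a uniformizer *)

Section UnramifiedAdjunction.
Variables (K V M : set algC) (l : nat).
Hypotheses (ld : local_domain K V M) (pl : prime l) (Ml : M l%:R).
Local Notation U := (lunit V M).
Let sK := ld_field ld.

Lemma lunit2 : l != 2%N -> U 2%:R.
Proof.
by move=> l2; apply: (lunit_nat ld pl Ml); rewrite dvdn_prime2.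
Qed.

Lemma lunit_prime p : prime p -> l != p -> U p%:R.
Proof. by move=> pp lp; apply: (lunit_nat ld pl Ml); rewrite dvdn_prime2. Qed.

(** The local criterion at [l] for a square root to leave the uniformizer unchanged, tame or wild
    according to [l]. Being closed under products, it reduces the radicands that are products to
    their factors. *)
Definition unr (F : set algC) (a : algC) : Prop :=
  if l == 2%N then U a /\ sq_mod4 V F a else sq_unit V M F a.

Lemma unrM F a b : subfield F -> unr F a -> unr F b -> unr F (a * b).
Proof.
rewrite /unr; case: ifP => _ sF; last exact: (sq_unitM ld).
move=> [Ua a4] [Ub b4]; split; first exact: (lunitM ld).
by apply: (sq_mod4M ld) => //; case: Ub.
Qed.

Lemma unr_sub F G a : F `<=` G -> unr F a -> unr G a.
Proof.
rewrite /unr; case: ifP => _ FG; last exact: sq_unit_sub.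
by move=> [Ua a4]; split=> //; exact: sq_mod4_sub a4.
Qed.

Lemma unr_sqr (F : set algC) (c : algC) : F c -> c != 0 -> (l = 2%N -> U c) -> unr F (c ^+ 2).
Proof.
rewrite /unr; case: (l =P 2%N) => [l2 Fc c0 /(_ l2) Uc|_ Fc c0 _].
  split; first by rewrite expr2; exact: (lunitM ld).
  exists c; split=> //; [by case: Uc|by rewrite subrr mul0r; exact: (V0 ld)].
by exists c, 1; split=> //; [exact: (lunit1 ld)|rewrite mulr1].
Qed.

Lemma unr_cong1 F a : subfield F -> U a -> V ((a - 1) / 4%:R) -> unr F a.
Proof.
move=> sF Ua Va; rewrite /unr; case: ifP => _; last exact: sq_unit_lunit.
split=> //; exists 1; split; [exact: subfield1|exact: (V1 ld)|].
by rewrite expr1n.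
Qed.

Lemma unr_prime F p : subfield F -> prime p -> (p = 1 %[mod 4])%N -> l != p -> unr F p%:R.
Proof.
move=> sF pp p4 lp; apply: unr_cong1 => //; first exact: lunit_prime.
have -> : (p%:R - 1) / 4%:R = (p %/ 4)%:R :> algC.
  by rewrite [in LHS](divn_eq p 4) p4 natrD natrM /= addrK mulfK ?pnatr_eq0.
exact: (V_nat ld).
Qed.

Lemma dvr_field_unr s pi r : dvr_field K V M (Qadj s) pi -> K r -> Qadj s (r ^+ 2) ->
  unr (Qadj s) (r ^+ 2) -> dvr_field K V M (Qadj (r :: s)) pi.
Proof.
move=> dF Kr Fr ur; have sub := Qadj_cons_sub Fr.
suff [_ FK [Mpi pi0 HF]] : dvr_field K V M (adj (Qadj s) r) pi.
  split; [exact: Qadj_subfield|by move=> w /sub; exact: FK|].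
  by split=> // a /sub; exact: HF.
move: ur; rewrite /unr; case: eqP => [l2 [Ua a4]|/eqP l2 a_sq].
  exact: (dvr_field_wild ld).
by apply: (dvr_field_tame ld) => //; exact: lunit2.
Qed.

Lemma dvr_field_ram s r : dvr_field K V M (Qadj s) (r ^+ 2) -> K r -> Qadj s (r ^+ 2) ->
  dvr_field K V M (Qadj (r :: s)) r.
Proof.
move=> dF Kr Fr; have sub := Qadj_cons_sub Fr.
have [_ FK [Mpi pi0 HF]] := dvr_field_ramified ld dF Kr Fr.
split; [exact: Qadj_subfield|by move=> w /sub; exact: FK|].
by split=> // a /sub; exact: HF.
Qed.

Lemma dvr_field_base : dvr_field K V M (Qadj [::]) l%:R.
Proof.
have [sQ QK [Mpi pi0 HF]] := dvr_field_Crat ld pl Ml.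
have sub : Qadj [::] `<=` [set w | w \in Crat] by apply: Qadj_min.
split; [exact: Qadj_subfield|by move=> w /sub; exact: QK|].
by split=> // a /sub; exact: HF.
Qed.

Lemma dvr_field_sqrt_prime s pi p : dvr_field K V M (Qadj s) pi -> K (sqrtC p%:R) ->
  prime p -> (p = 1 %[mod 4])%N -> l != p ->
  dvr_field K V M (Qadj (sqrtC p%:R :: s)) pi.
Proof.
move=> dF Kr pp p4 lp; have sS := Qadj_subfield s.
apply: dvr_field_unr => //; rewrite sqrtCK; first exact: subfield_nat.
exact: unr_prime.
Qed.

Lemma dvr_field_sqrt_ram s : dvr_field K V M (Qadj s) l%:R -> K (sqrtC l%:R) ->
  dvr_field K V M (Qadj (sqrtC l%:R :: s)) (sqrtC l%:R).
Proof.
move=> dF Kr; apply: dvr_field_ram => //; rewrite sqrtCK //.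
by apply: subfield_nat; exact: Qadj_subfield.
Qed.

Lemma sq_unit_root s G a : dvr_field K V M (Qadj s) l%:R -> subfield G -> G (sqrtC l%:R) ->
  Qadj s a -> a != 0 -> sq_unit V M G a.
Proof.
move=> [_ _ uF] sG Gr Fa a0; have [r Er Gr'] : exists2 r, r ^+ 2 = l%:R & G r.
  by exists (sqrtC l%:R); rewrite ?sqrtCK.
by apply: (sq_unit_uniformizer sG _ Gr' Fa a0); rewrite Er.
Qed.

(** Here [Y] stands for the whole irrational term and [X - Y] for the conjugate. For odd [l] one
    conjugate is a unit, so [X + Y] is a unit or [Z ^+ 2] times one. For [l = 2] both are units, and
    if only [X - Y] is known to be a square mod 4, the property passes to
    [X + Y = a * Z ^+ 2 / (X - Y)]. *)
Lemma unr_theta F X Y Z a : subfield F -> V X -> V Y -> F Z -> V Z -> Z != 0 -> U a ->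
  (X + Y) * (X - Y) = a * Z ^+ 2 ->
  (l != 2%N -> ~ (M (X + Y) /\ M (X - Y))) ->
  (l = 2%N -> [/\ U Z, sq_mod4 V F a & sq_mod4 V F (X + Y) \/ sq_mod4 V F (X - Y)]) ->
  unr F (X + Y).
Proof.
move=> sF hX hY FZ hZ Z0 Ua E Hodd Htwo.
have Vp : V (X + Y) by exact: (VD ld).
have Vm : V (X - Y) by exact: (VB ld).
rewrite /unr; case: eqP => [l2|/eqP l2].
  have [UZ a4 t4] := Htwo l2.
  have M2 : M 2%:R by rewrite -l2.
  have UaZ : U (a * Z ^+ 2) by rewrite expr2; apply: (lunitM ld) => //; exact: (lunitM ld).
  have Up : U (X + Y) by apply: (lunit_factor ld Vp Vm); rewrite E.
  have Um : U (X - Y) by apply: (lunit_factor ld Vm Vp); rewrite mulrC E.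
  split=> //; case: t4 => // m4.
  have -> : X + Y = a * Z ^+ 2 * (X - Y)^-1 by rewrite -E mulfK // (lunit_neq0 ld Um).
  have V2 : V (Z ^+ 2) by exact: (VX ld).
  apply: (sq_mod4M ld) => //; first exact: (lunitV_V ld).
    apply: (sq_mod4M ld) => //; exists Z; split=> //.
    by rewrite subrr mul0r; exact: (V0 ld).
  exact: (sq_mod4V ld).
have [Up|Mp] := lunit_or_max M Vp; first exact: sq_unit_lunit.
have [Um|Mm] := lunit_or_max M Vm; last by case: (Hodd l2).
exists Z, (a / (X - Y)); split=> //; first exact: (lunit_div ld).
by rewrite mulrA [Z ^+ 2 * a]mulrC -E mulfK // (lunit_neq0 ld Um).
Qed.

(* If [alpha] has odd valuation, both conjugates of [theta] in the maximal ideal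
   would force [b * Y ^+ 2] to have odd valuation too. *)
Lemma sq_unit_sqrt_theta F G rho X Y Z alpha beta b : l != 2%N ->
  dvr_field K V M F (rho ^+ 2) -> F (rho ^+ 2) ->
  subfield G -> F `<=` G -> G rho ->
  F X -> F Y -> F Z -> F alpha -> alpha != 0 -> beta ^+ 2 = alpha -> K beta ->
  U b -> Y != 0 -> Z != 0 -> X ^+ 2 - alpha * Z ^+ 2 = b * Y ^+ 2 ->
  sq_unit V M G (X + Z * beta).
Proof.
move=> l2 [sF FK uF] Fpi sG FG Grho FX FY FZ Fal al0 Ebeta Kbeta Ub Y0 Z0 E.
have [Mpi pi0 HF] := uF; set pi := rho ^+ 2 in Fpi uF Mpi pi0 HF *.
have rho0 : rho != 0 by move: pi0; rewrite /pi expf_eq0.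
have pz n : pi ^ n != 0 by rewrite expfz_neq0.
have Epi (i : int) : pi ^ i = (rho ^ i) ^+ 2 by rewrite /pi !exprnP exprzAC.
have [n [u [Uu Eal]]] := HF _ Fal al0.
(* The valuation of [alpha] is [2 * h + e]. Its even part is moved from [beta] to the coefficient
   [Z], so that [gam ^+ 2] is [pi ^ e] times a unit and [gam] lies in [V]. *)
pose h := (n %/ 2)%Z; pose e := (n %% 2)%Z.
have En : n = h + h + e by rewrite /h /e; lia.
have e01 : e = 0 \/ e = 1 by rewrite /e; lia.
pose gam := beta / pi ^ h.
have Egam : gam ^+ 2 = pi ^ e * u.
  rewrite /gam exprMn Ebeta Eal En !expfzDr // exprVn; field.
  by rewrite pz.
have Vpe : V (pi ^ e) by apply: (V_exprz ld); [exact: (MV ld)|case: e01 => ->].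
have Kgam : K gam.
  by apply: subfield_div => //; apply: FK; exact: subfield_exprz.
have Vgam : V gam.
  by apply: (V_sqr ld) => //; rewrite Egam; apply: (VM ld) => //; case: Uu.
pose Z1 := Z * pi ^ h.
have FZ1 : F Z1 by apply: subfieldM => //; exact: subfield_exprz.
have Z10 : Z1 != 0 by rewrite mulf_neq0.
have [k [X0 [Z0' [EX EZ VX0 VZ0 nM]]]] := common_scaling ld uF FX FZ1 (or_intror Z10).
have Etheta : X + Z * beta = pi ^ k * (X0 + Z0' * gam).
  have -> : Z * beta = Z1 * gam by rewrite /Z1 /gam; field; rewrite pz.
  by rewrite EX EZ; ring.
have Eprod : (X0 + Z0' * gam) * (X0 - Z0' * gam) = b * (Y / pi ^ k) ^+ 2.
  have -> : (X0 + Z0' * gam) * (X0 - Z0' * gam) = X0 ^+ 2 - Z0' ^+ 2 * gam ^+ 2 by ring.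
  have -> : b * (Y / pi ^ k) ^+ 2 = (b * Y ^+ 2) / (pi ^ k) ^+ 2 by field; rewrite pz.
  have -> : X0 = X / pi ^ k by rewrite EX; field; rewrite pz.
  have -> : Z0' = Z1 / pi ^ k by rewrite EZ; field; rewrite pz.
  by rewrite -E -Ebeta /Z1 /gam; field; rewrite !pz.
have Vp : V (X0 + Z0' * gam) by apply: (VD ld) => //; exact: (VM ld).
have Vm : V (X0 - Z0' * gam) by apply: (VB ld) => //; exact: (VM ld).
have sq_pi : sq_unit V M G (pi ^ k).
  exists (rho ^ k), 1; split; [exact: subfield_exprz|by rewrite expfz_neq0|exact: (lunit1 ld)|].
  by rewrite mulr1 Epi.
rewrite Etheta; apply: (sq_unitM ld) => //.
have [Up|Mp] := lunit_or_max M Vp; first exact: sq_unit_lunit.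
have [Um|Mm] := lunit_or_max M Vm.
  exists (Y / pi ^ k), (b / (X0 - Z0' * gam)); split.
  - by apply: FG; apply: subfield_div => //; exact: subfield_exprz.
  - by rewrite mulf_neq0 // invr_neq0.
  - exact: (lunit_div ld).
  - by rewrite mulrA [_ ^+ 2 * b]mulrC -Eprod mulfK // (lunit_neq0 ld Um).
exfalso.
have U2 := lunit2 l2.
have MX0 : M X0.
  apply: (lunit_max_factor ld VX0 U2).
  have -> : X0 * 2%:R = (X0 + Z0' * gam) + (X0 - Z0' * gam) by ring.
  exact: (MD ld).
have UZ0 : U Z0' by have [//|MZ0] := lunit_or_max M VZ0; case: nM.
have Mgam : M gam.
  have : M (Z0' * gam).
    by have -> : Z0' * gam = (X0 + Z0' * gam) - X0 by [ring]; exact: (MB ld).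
  by rewrite mulrC; exact: (lunit_max_factor ld Vgam UZ0).
(* For [e = 0], [gam] would be a unit. For [e = 1], [pi] divides [X0], so the product of the
   conjugates has valuation 1, against the even valuation of [b * (Y / pi ^ k) ^+ 2]. *)
have [e0|e1] := e01.
  have : U (gam ^+ 2) by rewrite Egam e0 expr0z mul1r.
  by case=> _; apply; rewrite expr2; exact: (VMM ld).
have FX0 : F X0.
  have -> : X0 = X / pi ^ k by rewrite EX; field; rewrite pz.
  by apply: subfield_div => //; exact: subfield_exprz.
have [v Vv EX0] := uniformizer_dvd ld uF FX0 MX0.
have Yk0 : Y / pi ^ k != 0 by rewrite mulf_neq0 // invr_neq0.
have FYk : F (Y / pi ^ k) by apply: subfield_div => //; exact: subfield_exprz.
have [j [t [Ut EY]]] := HF _ FYk Yk0.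
have : pi ^ 1 * (- (Z0' ^+ 2 * u) + pi * v ^+ 2) = pi ^ (j + j) * (b * t ^+ 2).
  have -> : pi ^ (j + j) * (b * t ^+ 2) = b * (pi ^ j * t) ^+ 2.
    by rewrite expfzDr //; ring.
  rewrite -EY -Eprod.
  have -> : (X0 + Z0' * gam) * (X0 - Z0' * gam) = X0 ^+ 2 - Z0' ^+ 2 * gam ^+ 2 by ring.
  by rewrite Egam e1 expr1z EX0; ring.
move/(exprz_unit_inj ld Mpi pi0) => H.
suff : (1 : int) = j + j by lia.
apply: H.
  apply: (lunitD_max ld).
    apply: (lunitN ld); apply: (lunitM ld) => //.
    by rewrite expr2; exact: (lunitM ld).
  by apply: (MVM ld) => //; exact: (VX ld).
by apply: (lunitM ld) => //; rewrite expr2; exact: (lunitM ld).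
Qed.

End UnramifiedAdjunction.

(** * The tower *)

(** For [l] in [ps], the root of [l] lies in [P] by primality, which puts [l] in the square of [P],
    and its being a uniformizer keeps [l] out of the cube. For other [l], the uniformizer [l] is not
    in the square. *)
Lemma ramification_of_uniformizers (ps : seq nat) (K : set algC) : subfield K ->
  (forall p, p \in ps -> prime p /\ K (sqrtC p%:R)) ->
  (forall l P, prime l -> prime_over K l P ->
     uniformizer (loc K P) (locmax K P) K (if l \in ps then sqrtC l%:R else l%:R)) ->
  (forall l, prime l -> (ramified K l <-> l \in ps)) /\
  (forall l, l \in ps -> forall P, prime_over K l P -> ram_index K l P 2).
Proof.
move=> sK Hps unif.
have ram2 l : l \in ps -> forall P, prime_over K l P -> ram_index K l P 2.
  move=> lps P ovP; have [pl Kr] := Hps _ lps; have [pP Pl] := ovP.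
  have ld := loc_local_domain sK pP.
  have := unif _ _ pl ovP; rewrite lps => uK.
  have Ar : ringint K (sqrtC l%:R).
    split=> //; apply: (@Aint_quadratic _ 0 l%:R); rewrite ?Aint0 ?rpred_nat //.
    by rewrite sqrtCK mul0r add0r.
  have Pr : P (sqrtC l%:R).
    by case: (pP) => _ _ /(_ _ _ Ar Ar); rewrite -expr2 sqrtCK => /(_ Pl)[].
  split.
    exists 1%N, (fun=> sqrtC l%:R), (fun=> sqrtC l%:R); split=> //.
      move=> _; exists 1%N, (fun=> sqrtC l%:R), (fun=> 1); split=> //.
        by move=> _; exact: ringint1.
      by rewrite big_ord1 mulr1.
    by rewrite big_ord1 -expr2 sqrtCK.
  move=> P3; have := ram_exponent_le sK pP uK (lunit1 ld) _ P3 (e := 2).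
  by rewrite mulr1 sqrtCK => /(_ erefl).
split=> // l pl; split=> [[P [e [ovP [Pe _] e1]]]|lps].
  apply: contraT => nlps; have [pP Pl] := ovP.
  have ld := loc_local_domain sK pP.
  have := unif _ _ pl ovP; rewrite (negPf nlps) => uK.
  have := ram_exponent_le sK pP uK (lunit1 ld) _ Pe (e := 1).
  by rewrite expr1 mulr1 => /(_ erefl); lia.
have [P ovP] := prime_over_exists sK pl.
by exists P, 2%N; split=> //; exact: ram2.
Qed.

Lemma eq_or_oppr_sqr (a b : algC) : a ^+ 2 = b ^+ 2 -> a = b \/ a = - b.
Proof. by move/eqP; rewrite eqf_sqr => /orP[] /eqP; [left|right]. Qed.

(** * The generators of [K] at a fixed prime *)

Section Place.
Variables (p1 p2 p3 : nat) (x y z : int) (m : nat) (K : set algC).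
Variable nu : {rmorphism algC -> algC}.
Local Notation r1 := (sqrtC p1%:R : algC).
Local Notation r2 := (sqrtC p2%:R : algC).
Local Notation r3 := (sqrtC p3%:R : algC).
Local Notation k := (Qadj [:: r1]).
Local Notation alpha := (redei_elt p1 x y).
Hypotheses (pp1 : prime p1) (pp2 : prime p2) (pp3 : prime p3).
Hypotheses (p14 : (p1 = 1 %[mod 4])%N) (p24 : (p2 = 1 %[mod 4])%N) (p34 : (p3 = 1 %[mod 4])%N).
Hypotheses (p12 : p1 != p2) (p13 : p1 != p3) (p23 : p2 != p3).
Hypothesis nu_r1 : nu r1 = - r1.
Hypothesis cn : class_number k 1.
Hypothesis sol : redei_solution p1 p2 x y z.
Hypothesis alpha_dvd : int_dvd k alpha (p2%:R ^+ m).
Hypothesis sK : subfield K.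
Hypotheses (Kr1 : K r1) (Kr2 : K r2) (Kr3 : K r3).

Let sk : subfield k. Proof. exact: Qadj_subfield. Qed.
Let kr1 : k r1. Proof. by apply: Qadj_mem; rewrite inE. Qed.
Let kK : k `<=` K.
Proof. by apply: Qadj_min => // w; rewrite inE => /eqP ->. Qed.

Lemma alpha_in_k : k alpha.
Proof. by apply: (subfieldD sk); [|apply: (subfieldM sk) => //]; exact: (subfield_int sk). Qed.

Lemma conj_alpha : nu alpha = x%:~R - y%:~R * r1.
Proof. by rewrite /redei_elt rmorphD rmorphM /= !rmorph_int nu_r1 mulrN. Qed.

(** The norm equation; through it [sqrtC (nu alpha)] lies in any field containing [r2] and
    [sqrtC alpha]. *)
Lemma alpha_conj_mul : alpha * nu alpha = p2%:R * z%:~R ^+ 2.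
Proof.
case: sol => E _ _ _; rewrite conj_alpha /redei_elt.
have -> : (x%:~R + y%:~R * r1) * (x%:~R - y%:~R * r1) = x%:~R ^+ 2 - r1 ^+ 2 * y%:~R ^+ 2 by ring.
rewrite sqrtCK; apply/eqP; rewrite -subr_eq0; apply/eqP.
have := congr1 (fun n : int => n%:~R : algC) E.
by rewrite !rmorphB !rmorphM /= -!pmulrn => H; rewrite -[RHS]H; ring.
Qed.

Lemma alpha_neq0 : alpha != 0.
Proof.
apply/eqP => a0; case: alpha_dvd => c _ /eqP; rewrite a0 mul0r expf_eq0 pnatr_eq0.
by case/andP => _ /eqP p20; move: pp2; rewrite p20.
Qed.

(** Writing [y = 2 * y'] and [x = y + 1 + 4 * t], the quotient is [t + y' * (1 + r1) / 2], integral
    because [p1] is 1 mod 4. *)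
Lemma alpha_cong1 : ringint k ((alpha - 1) / 4%:R).
Proof.
have [_ _ y2 xy] := sol.
have [y' Ey] : exists y', y = 2 * y' by exists (y %/ 2)%Z; move: y2; lia.
have [t Et] : exists t, x = y + 1 + 4 * t by exists ((x - y) %/ 4)%Z; move: xy; lia.
have -> : (alpha - 1) / 4%:R = t%:~R + y'%:~R * ((1 + r1) / 2%:R).
  rewrite /redei_elt Et Ey !rmorphD !rmorphM /= rmorph1.
  by field.
split; last first.
  rewrite rpredD ?Aint_int // rpredM ?Aint_int //.
  apply: (@Aint_quadratic _ 1 (p1 %/ 4)%:R); rewrite ?rpred1 ?rpred_nat //.
  have E : r1 ^+ 2 = (p1 %/ 4)%:R * 4%:R + 1.
    by rewrite sqrtCK {1}(divn_eq p1 4) p14 natrD natrM.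
  have -> : ((1 + r1) / 2%:R) ^+ 2 = (1 + 2%:R * r1 + r1 ^+ 2) / 4%:R by field.
  by rewrite E; field.
apply: (subfieldD sk); first exact: (subfield_int sk).
apply: (subfieldM sk); first exact: (subfield_int sk).
apply: (subfield_div sk); last exact: (subfield_nat sk).
by apply: (subfieldD sk) => //; exact: (subfield1 sk).
Qed.

Variables (l : nat) (P : set algC).
Hypotheses (pl : prime l) (ovP : prime_over K l P).
Local Notation V := (loc K P).
Local Notation M := (locmax K P).
Local Notation U := (lunit V M).

Let pP : is_prime K P. Proof. by case: ovP. Qed.
Let ld : local_domain K V M. Proof. exact: loc_local_domain. Qed.
Let Ml : M l%:R. Proof. by apply: prime_locmax => //; case: ovP. Qed.

Let V_Aint w : K w -> w \in Aint -> V w.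
Proof. by move=> Kw Aw; apply: ringint_loc. Qed.
Let V_k w : ringint k w -> V w.
Proof. by move=> [kw Aw]; apply: V_Aint => //; exact: kK. Qed.

Lemma sqrt_Aint (a : algC) : a \in Aint -> sqrtC a \in Aint.
Proof. by move=> Aa; apply: (@Aint_quadratic _ 0 a); rewrite ?Aint0 // sqrtCK mul0r add0r. Qed.

Lemma coprime_not_all_max s : int_coprime k s -> (forall w, w \in s -> ringint k w) ->
  exists2 w, w \in s & ~ M w.
Proof.
move=> cop sint; have [w ws nPw] := coprime_not_all_in_prime sk kK cn pl ovP cop sint.
exists w => // Mw; apply: nPw; apply: (locmax_ringint pP) Mw.
by have [kw Aw] := sint _ ws; split=> //; exact: kK.
Qed.

Lemma coprime2_lunit w : l = 2%N -> ringint k w -> int_coprime k [:: w; 2%:R] -> U w.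
Proof.
move=> l2 kw cop; have [|v] := coprime_not_all_max cop.
  by move=> v; rewrite !inE => /orP[] /eqP -> //; exact: ringint_nat.
rewrite !inE => /orP[] /eqP -> nM; first by split=> //; exact: V_k.
by case: nM; rewrite -l2.
Qed.

Lemma coprime3_not_max X Y Z : ringint k X -> ringint k Y -> ringint k Z ->
  int_coprime k [:: X; Y; Z] -> M X -> M Y -> M Z -> False.
Proof.
move=> kX kY kZ cop MX MY MZ; have [|w] := coprime_not_all_max cop.
  by move=> w; rewrite !inE => /or3P[] /eqP ->.
by rewrite !inE => /or3P[] /eqP ->.
Qed.

(** Both [alpha] and its conjugate divide a power of [p2], which is a unit away from [p2]. *)
Lemma alpha_lunit : l != p2 -> U alpha /\ U (nu alpha).
Proof.
move=> lp2; have Up : U (p2%:R ^+ m).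
  rewrite -natrX; apply: (lunit_nat ld pl Ml).
  by apply: contra lp2; rewrite Euclid_dvdX // dvdn_prime2 // => /andP[].
have Aa : ringint k alpha.
  split; first exact: alpha_in_k.
  rewrite /redei_elt rpredD ?Aint_int // rpredM ?Aint_int //.
  by apply: sqrt_Aint; rewrite rpred_nat.
have [c kc E] := alpha_dvd.
split; first by apply: (lunit_factor ld (V_k Aa) (V_k kc)); rewrite -E.
apply: (lunit_factor ld (V_k (conj_ringint nu_r1 Aa)) (V_k (conj_ringint nu_r1 kc))).
by rewrite -rmorphM -E rmorphXn rmorph_nat.
Qed.

Lemma unr_alpha F : subfield F -> l != p2 ->
  unr V M l F alpha /\ unr V M l F (nu alpha).
Proof.
move=> sF /alpha_lunit[Ua Ua']; split; apply: (unr_cong1 l ld) => //.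
  by apply: V_k; exact: alpha_cong1.
have -> : (nu alpha - 1) / 4%:R = nu ((alpha - 1) / 4%:R).
  by rewrite fmorph_div rmorphB rmorph1 rmorph_nat.
by apply: V_k; apply: conj_ringint => //; exact: alpha_cong1.
Qed.

Lemma unr_sq_unit F a : l != 2%N -> sq_unit V M F a -> unr V M l F a.
Proof. by rewrite /unr => /negPf ->. Qed.

Lemma unr_two F a : l = 2%N -> unr V M l F a -> sq_mod4 V F a.
Proof. by move=> l2; rewrite /unr l2 => -[]. Qed.

Lemma p_neq2 p : (p = 1 %[mod 4])%N -> p != 2%N.
Proof. by move=> p4; apply/eqP => p2'; move: p4; rewrite p2'. Qed.

(** The automorphism [mu] lets one congruence serve twice: as it stands with [mu = idfun], and for
    the conjugate with [mu = nu]. *)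
Lemma sq_mod4_cong (L F : set algC) (mu : {rmorphism algC -> algC}) lam theta :
  (forall w, L w -> F (mu w) /\ K (mu w)) -> ringint L lam ->
  int_cong L 4%:R (lam ^+ 2) theta -> sq_mod4 V F (mu theta).
Proof.
move=> LF [Ll Al] [c [Lc Ac] E]; exists (mu lam).
have [Fl Kl] := LF _ Ll; have [Fc Kc] := LF _ Lc.
split=> //; first by apply: V_Aint => //; rewrite Aint_aut.
have -> : (mu theta - mu lam ^+ 2) / 4%:R = - mu c.
  have -> : theta = lam ^+ 2 - 4%:R * c by rewrite -E opprB addrC subrK.
  by rewrite rmorphB rmorphXn (rmorphM mu 4%:R) rmorph_nat; field.
by apply: (VN ld); apply: V_Aint => //; rewrite Aint_aut.
Qed.

(** All three radicands lie in [Qadj s], so the criterion is checked there once and persists in the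
    larger fields. *)
Lemma dvr_field_unr3 s pi a b c : dvr_field K V M (Qadj s) pi ->
  K (sqrtC a) -> K (sqrtC b) -> K (sqrtC c) ->
  Qadj s a -> Qadj s b -> Qadj s c ->
  unr V M l (Qadj s) a -> unr V M l (Qadj s) b -> unr V M l (Qadj s) c ->
  dvr_field K V M (Qadj [:: sqrtC c, sqrtC b, sqrtC a & s]) pi.
Proof.
move=> dF Ka Kb Kc Fa Fb Fc ua ub uc.
have sub1 : Qadj s `<=` Qadj (sqrtC a :: s).
  by apply: Qadj_sub => w ws; rewrite inE ws orbT.
have sub2 : Qadj s `<=` Qadj [:: sqrtC b, sqrtC a & s].
  by apply: Qadj_sub => w ws; rewrite !inE ws !orbT.
have d1 : dvr_field K V M (Qadj (sqrtC a :: s)) pi.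
  by apply: (dvr_field_unr ld pl Ml) => //; rewrite sqrtCK.
have d2 : dvr_field K V M (Qadj [:: sqrtC b, sqrtC a & s]) pi.
  apply: (dvr_field_unr ld pl Ml) => //; rewrite sqrtCK; first exact: sub1.
  exact: unr_sub ub.
apply: (dvr_field_unr ld pl Ml) => //; rewrite sqrtCK; first exact: sub2.
exact: unr_sub uc.
Qed.

Lemma dvr_field_k : dvr_field K V M k (if l == p1 then r1 else l%:R).
Proof.
have d0 := dvr_field_base ld pl Ml.
case: eqP => [E|/eqP lp1]; last exact: (dvr_field_sqrt_prime ld pl Ml).
by rewrite -E; apply: (dvr_field_sqrt_ram ld) => //; rewrite E.
Qed.

Lemma dvr_field_k_neq : l != p1 -> dvr_field K V M k l%:R.
Proof. by move=> lp1; have := dvr_field_k; rewrite (negPf lp1). Qed.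

Lemma uniformizer_sub S pi : dvr_field K V M (Qadj S) pi -> K `<=` Qadj S ->
  uniformizer V M K pi.
Proof. by move=> [_ _ [Mpi pi0 HF]] sub; split=> // a /sub; exact: HF. Qed.

(** The field [k13], with its generators in tower order, the last adjoined first. *)
Let L := Qadj [:: r3; r1].
Let sL : subfield L. Proof. exact: Qadj_subfield. Qed.
Let Lr3 : L r3. Proof. by apply: Qadj_mem; rewrite inE eqxx. Qed.
Let kL : k `<=` L.
Proof. by apply: Qadj_sub; apply/allP; rewrite /= !inE !eqxx !orbT. Qed.
Let LK : L `<=` K.
Proof. by apply: Qadj_min => // w; rewrite !inE => /orP[] /eqP ->. Qed.

(** For odd [l], if both conjugates lay in [M], their sum would put [X] there and their product [Z];
    then [Y] follows, against coprimality. *)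
Lemma unr_theta_k13 X Y Z a :
  ringint k X -> ringint k Y -> ringint k Z -> Z != 0 ->
  X ^+ 2 - p3%:R * Y ^+ 2 - a * Z ^+ 2 = 0 -> int_coprime k [:: X; Y; Z] ->
  (l = 2%N -> U Z) -> U a -> unr V M l L a ->
  (l = 2%N -> sq_mod4 V L (X + Y * r3) \/ sq_mod4 V L (X - Y * r3)) ->
  unr V M l L (X + Y * r3).
Proof.
move=> kX kY kZ Z0 E cop UZ Ua ua t4.
have hX := V_k kX; have hY := V_k kY; have hZ := V_k kZ.
have hr3 : V r3 by apply: V_Aint => //; apply: sqrt_Aint; rewrite rpred_nat.
have {}E : X ^+ 2 - p3%:R * Y ^+ 2 = a * Z ^+ 2.
  by apply/eqP; rewrite -subr_eq0 E.
have Eth : (X + Y * r3) * (X - Y * r3) = a * Z ^+ 2.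
  rewrite -E -[in RHS](sqrtCK (p3%:R : algC)); ring.
apply: (unr_theta ld Ml sL hX (VM ld hY hr3) _ hZ Z0 Ua Eth).
- by apply: kL; case: kZ.
- move=> l2 [Mp Mm].
  have MX : M X.
    apply: (lunit_max_factor ld hX (lunit2 ld pl Ml l2)).
    have -> : X * 2%:R = (X + Y * r3) + (X - Y * r3) by ring.
    exact: (MD ld).
  have MZ : M Z.
    apply: (M_sqr ld hZ); apply: (lunit_max_factor ld _ Ua); first exact: (VX ld).
    by rewrite mulrC -Eth; apply: (MVM ld) => //; exact: (MV ld).
  apply: (coprime3_not_max kX kY kZ cop MX _ MZ).
  have [lp3|lp3] := eqVneq l p3; last first.
    apply: (lunit_max_factor ld hY (b := r3)).
      by apply: (lunit_sqrt ld) => //; rewrite sqrtCK; exact: (lunit_prime ld pl Ml).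
    have -> : Y * r3 = (X + Y * r3) - X by ring.
    exact: (MB ld).
  (* At [p3] the root [r3] is not a unit, but [l] is a uniformizer of [k] and divides [X] and [Z];
     hence [l * Y ^+ 2] is divisible by [l ^+ 2]. *)
  have [_ _ uk] : dvr_field K V M k l%:R by apply: dvr_field_k_neq; rewrite lp3 eq_sym.
  have [X1 VX1 EX] := uniformizer_dvd ld uk (proj1 kX) MX.
  have [Z1 VZ1 EZ] := uniformizer_dvd ld uk (proj1 kZ) MZ.
  apply: (M_sqr ld hY).
  have l0 : (l%:R : algC) != 0 by rewrite pnatr_eq0 -lt0n prime_gt0.
  have -> : Y ^+ 2 = l%:R * (X1 ^+ 2 - a * Z1 ^+ 2).
    apply: (mulfI l0).
    have -> : l%:R * Y ^+ 2 = X ^+ 2 - a * Z ^+ 2 by rewrite -E lp3; ring.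
    by rewrite EX EZ; ring.
  apply: (MVM ld) => //; apply: (VB ld); first exact: (VX ld).
  by apply: (VM ld); [case: Ua|exact: (VX ld)].
- by move=> l2; split; [exact: UZ|exact: unr_two ua|exact: t4].
Qed.

Local Notation piL := (if l \in [:: p1; p2; p3] then sqrtC l%:R else l%:R : algC).

Lemma dvr_field_k13 : l != p2 -> dvr_field K V M L piL.
Proof.
move=> lp2; rewrite !inE (negPf lp2) /=.
have := dvr_field_k; have [lp1|lp1] := eqVneq l p1 => /= dk.
  apply: (dvr_field_sqrt_prime ld pl Ml) => //; first by rewrite lp1.
  by rewrite lp1.
have [lp3|lp3] := eqVneq l p3; last exact: (dvr_field_sqrt_prime ld pl Ml).
by rewrite /L -lp3; apply: (dvr_field_sqrt_ram ld) => //; rewrite lp3.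
Qed.

(** The case of [Z] prime to 2. The last three radicands lie in [k13], and [theta1 * theta2] is
    [alpha * Z ^+ 2]; only at [p2] can [alpha] fail to be a unit. *)
Lemma uniformizer_theta X Y Z lam :
  ringint k X -> ringint k Y -> ringint k Z ->
  X ^+ 2 - p3%:R * Y ^+ 2 - alpha * Z ^+ 2 = 0 -> int_coprime k [:: X; Y; Z] ->
  int_coprime k [:: Z; 2%:R] ->
  ringint (Qadj [:: r1; r3]) lam ->
  int_cong (Qadj [:: r1; r3]) 4%:R (lam ^+ 2) (X + Y * r3) ->
  K = Qadj [:: r1; r2; r3; sqrtC ((X + Y * r3) * (X - Y * r3));
               sqrtC ((X + Y * r3) * (nu X + nu Y * r3)); sqrtC (X + Y * r3)] ->
  uniformizer V M K piL.
Proof.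
move=> kX kY kZ E cop cop2 Llam lamE Kdef.
have Z0 : Z != 0 by apply/eqP => Z0; apply: (@int_coprime_0_2 k) => //; rewrite -Z0.
have nuX := conj_ringint nu_r1 kX; have nuY := conj_ringint nu_r1 kY.
have nuZ := conj_ringint nu_r1 kZ.
have nuZ0 : nu Z != 0 by rewrite fmorph_eq0.
have nuE : nu X ^+ 2 - p3%:R * nu Y ^+ 2 - nu alpha * nu Z ^+ 2 = 0.
  rewrite -!rmorphXn -(rmorph_nat nu p3) -!(rmorphM nu) -!rmorphB.
  by rewrite E rmorph0.
have nucop : int_coprime k [:: nu X; nu Y; nu Z].
  apply: (int_coprime_conj nu_r1 (s := [:: X; Y; Z])) => // w.
  by rewrite !inE => /or3P[] /eqP ->; [case: kX|case: kY|case: kZ].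
have nucop2 : int_coprime k [:: nu Z; 2%:R].
  rewrite -(rmorph_nat nu 2).
  apply: (int_coprime_conj nu_r1 (s := [:: Z; 2%:R])) => // w.
  by rewrite !inE => /orP[] /eqP ->; [case: kZ|exact: (subfield_nat sk)].
have Kgen w : w \in [:: r1; r2; r3; sqrtC ((X + Y * r3) * (X - Y * r3));
               sqrtC ((X + Y * r3) * (nu X + nu Y * r3)); sqrtC (X + Y * r3)] -> K w.
  by rewrite Kdef; exact: Qadj_mem.
have theta12 : (X + Y * r3) * (X - Y * r3) = alpha * Z ^+ 2.
  have -> : alpha * Z ^+ 2 = X ^+ 2 - r3 ^+ 2 * Y ^+ 2.
    by rewrite sqrtCK; apply/eqP; rewrite eq_sym -subr_eq0 E.
  by ring.
have theta34 : (nu X + nu Y * r3) * (nu X - nu Y * r3) = nu alpha * nu Z ^+ 2.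
  have -> : nu alpha * nu Z ^+ 2 = nu X ^+ 2 - r3 ^+ 2 * nu Y ^+ 2.
    by rewrite sqrtCK; apply/eqP; rewrite eq_sym -subr_eq0 nuE.
  by ring.
have Lk w : ringint k w -> L w by move=> [kw _]; exact: kL.
have Lth1 : L (X + Y * r3) by apply: (subfieldD sL); [|apply: (subfieldM sL)] => //; exact: Lk.
have Lth2 : L (X - Y * r3) by apply: (subfieldB sL); [|apply: (subfieldM sL)] => //; exact: Lk.
have Lth3 : L (nu X + nu Y * r3).
  by apply: (subfieldD sL); [|apply: (subfieldM sL)] => //; exact: Lk.
have LaZ : L (alpha * Z ^+ 2) by rewrite -theta12; exact: (subfieldM sL).
have Lth13 : L ((X + Y * r3) * (nu X + nu Y * r3)) by exact: (subfieldM sL).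
pose gens := [:: sqrtC (X + Y * r3); sqrtC ((X + Y * r3) * (nu X + nu Y * r3));
                 sqrtC ((X + Y * r3) * (X - Y * r3)); r2; r3; r1].
suff dK : dvr_field K V M (Qadj gens) piL.
  apply: (uniformizer_sub dK); rewrite Kdef; apply: Qadj_sub; apply/allP.
  by rewrite /= !inE !eqxx !orbT.
have sub : L `<=` Qadj [:: r2; r3; r1].
  by apply: Qadj_sub; apply/allP; rewrite /= !inE !eqxx !orbT.
have sS := Qadj_subfield [:: r2; r3; r1].
(* At [p2], [l] is still a uniformizer of [k13]; once [r2] is adjoined, every nonzero element of
   [k13] has even valuation. *)
have [lp2|lp2] := eqVneq l p2.
  have l2 : l != 2%N by rewrite lp2; exact: p_neq2.
  have -> : l \in [:: p1; p2; p3] by rewrite lp2 !inE eqxx orbT.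
  have dL : dvr_field K V M L l%:R.
    apply: (dvr_field_sqrt_prime ld pl Ml) => //; last by rewrite lp2.
    by apply: dvr_field_k_neq; rewrite lp2 eq_sym.
  have dS : dvr_field K V M (Qadj [:: r2; r3; r1]) (sqrtC l%:R).
    by rewrite -lp2; apply: (dvr_field_sqrt_ram ld) => //; rewrite lp2.
  have nz1 : (X + Y * r3) * (X - Y * r3) != 0.
    by rewrite theta12 mulf_neq0 ?expf_neq0 //; exact: alpha_neq0.
  have nz3 : (nu X + nu Y * r3) * (nu X - nu Y * r3) != 0.
    by rewrite theta34 mulf_neq0 ?expf_neq0 ?fmorph_eq0 //; exact: alpha_neq0.
  have sq a : L a -> a != 0 -> unr V M l (Qadj [:: r2; r3; r1]) a.
    move=> La a0; apply: unr_sq_unit => //.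
    apply: (sq_unit_root dL) => //.
    by apply: Qadj_mem; rewrite lp2 inE eqxx.
  move: (nz1) (nz3); rewrite !mulf_eq0 !negb_or => /andP[n1 n2] /andP[n3 n4].
  apply: dvr_field_unr3 => //; try by apply: Kgen; rewrite !inE eqxx ?orbT.
  all: try exact: sub.
  - by apply: sub; rewrite theta12.
  - by apply: sq => //; rewrite theta12.
  - by apply: sq => //; exact: mulf_neq0.
  - exact: sq.
have [Ua Ua'] := alpha_lunit lp2.
have [ua ua'] := unr_alpha sL lp2.
have nuL w : Qadj [:: r1; r3] w -> L (nu w).
  apply: (@Qadj_min _ [set w | L (nu w)]); first exact: preim_subfield.
  move=> v; rewrite !inE => /orP[] /eqP -> /=.
    by rewrite nu_r1; apply: (subfieldN sL); exact: kL.
  have [|->|->] := @eq_or_oppr_sqr (nu r3) r3; last exact: (subfieldN sL).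
    by rewrite -rmorphXn sqrtCK rmorph_nat.
  by [].
have subL : Qadj [:: r1; r3] `<=` L.
  by apply: Qadj_sub; apply/allP; rewrite /= !inE !eqxx !orbT.
have u1 : unr V M l L (X + Y * r3).
  apply: (unr_theta_k13 kX kY kZ) E cop _ Ua ua _ => //.
    by move=> l2; exact: coprime2_lunit.
  move=> _; left; apply: (sq_mod4_cong (mu := idfun) _ Llam lamE) => w /= Lw.
  by have := subL _ Lw => Lw'; split=> //; exact: LK.
have u3 : unr V M l L (nu X + nu Y * r3).
  apply: (unr_theta_k13 nuX nuY nuZ) nuE nucop _ Ua' ua' _ => //.
    by move=> l2; exact: coprime2_lunit.
  move=> _; have := @sq_mod4_cong _ L nu _ _ _ Llam lamE.
  rewrite rmorphD rmorphM /=.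
  (* The sign of [nu r3] is undetermined, so the congruence holds for [nu X + nu Y * r3] or for its
     conjugate; either is enough. *)
  have [|->|->] := @eq_or_oppr_sqr (nu r3) r3.
  - by rewrite -rmorphXn sqrtCK rmorph_nat.
  - by move=> H; left; apply: H => w /nuL Lw; split=> //; exact: LK.
  - by rewrite mulrN => H; right; apply: H => w /nuL Lw; split=> //; exact: LK.
have u12 : unr V M l L ((X + Y * r3) * (X - Y * r3)).
  rewrite theta12; apply: (unrM ld) => //; apply: (unr_sqr ld) => //; first exact: Lk.
  by move=> l2; exact: coprime2_lunit.
have dS : dvr_field K V M (Qadj [:: r2; r3; r1]) piL.
  apply: (dvr_field_sqrt_prime ld pl Ml) => //.
  exact: dvr_field_k13.
apply: dvr_field_unr3 => //; try by apply: Kgen; rewrite !inE eqxx ?orbT.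
all: try exact: sub.
- by apply: sub; rewrite theta12.
- exact: unr_sub u12.
- by apply: unr_sub sub _; exact: (unrM ld).
- exact: unr_sub u1.
Qed.

(** The roles of [Y] and [Z] are exchanged: the product of the conjugates is [p3 * Y ^+ 2]. Since
    [p3] and [beta] are units, both conjugates in [M] would again put [X], [Y] and [Z] there. *)
Lemma unr_theta_sqrt_alpha F X Y Z a beta : subfield F -> F Y -> l != p3 ->
  ringint k X -> ringint k Y -> ringint k Z -> Y != 0 -> K beta -> beta ^+ 2 = a -> U a ->
  X ^+ 2 - p3%:R * Y ^+ 2 - a * Z ^+ 2 = 0 -> int_coprime k [:: X; Y; Z] ->
  (l = 2%N -> U Y) ->
  (l = 2%N -> sq_mod4 V F (X + Z * beta) \/ sq_mod4 V F (X - Z * beta)) ->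
  unr V M l F (X + Z * beta).
Proof.
move=> sF FY lp3 kX kY kZ Y0 Kb Eb Ua E cop UY t4.
have hX := V_k kX; have hY := V_k kY; have hZ := V_k kZ.
have Ub : U beta by apply: (lunit_sqrt ld) => //; rewrite Eb.
have Up3 : U p3%:R by exact: (lunit_prime ld pl Ml).
have Eth : (X + Z * beta) * (X - Z * beta) = p3%:R * Y ^+ 2.
  have -> : p3%:R * Y ^+ 2 = X ^+ 2 - a * Z ^+ 2.
    by apply/eqP; rewrite eq_sym -subr_eq0 addrAC E.
  by rewrite -Eb; ring.
have hb : V beta by case: Ub.
apply: (unr_theta ld Ml sF hX (VM ld hZ hb) FY hY Y0 Up3 Eth).
- move=> l2 [Mp Mm].
  have MX : M X.
    apply: (lunit_max_factor ld hX (lunit2 ld pl Ml l2)).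
    have -> : X * 2%:R = (X + Z * beta) + (X - Z * beta) by ring.
    exact: (MD ld).
  apply: (coprime3_not_max kX kY kZ cop MX).
  + apply: (M_sqr ld hY); apply: (lunit_max_factor ld _ Up3); first exact: (VX ld).
    by rewrite mulrC -Eth; apply: (MVM ld) => //; exact: (MV ld).
  + apply: (lunit_max_factor ld hZ Ub).
    have -> : Z * beta = (X + Z * beta) - X by ring.
    exact: (MB ld).
- move=> l2; split; [exact: UY|apply: unr_two => //|exact: t4].
  exact: (unr_prime ld pl Ml).
Qed.

(** The case of [Y] prime to 2, with [sqrtC alpha] inserted in the tower before the last three
    generators. The primes [p3] and [p2] are separate, since [p3], respectively [alpha], may not be
    a unit there. *)
Lemma uniformizer_theta' X Y Z lam :
  ringint k X -> ringint k Y -> ringint k Z -> Z != 0 ->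
  X ^+ 2 - p3%:R * Y ^+ 2 - alpha * Z ^+ 2 = 0 -> int_coprime k [:: X; Y; Z] ->
  int_coprime k [:: Y; 2%:R] ->
  ringint (Qadj [:: r1; sqrtC alpha]) lam ->
  int_cong (Qadj [:: r1; sqrtC alpha]) 4%:R (lam ^+ 2) (X + Z * sqrtC alpha) ->
  K = Qadj [:: r1; r2; r3; sqrtC ((X + Z * sqrtC alpha) * (X - Z * sqrtC alpha));
               sqrtC ((X + Z * sqrtC alpha) * (nu X + nu Z * sqrtC (nu alpha)));
               sqrtC (X + Z * sqrtC alpha)] ->
  uniformizer V M K piL.
Proof.
move=> kX kY kZ Z0 E cop cop2 Llam lamE.
set beta := sqrtC alpha in Llam lamE *; set beta' := sqrtC (nu alpha) => Kdef.
have Y0 : Y != 0 by apply/eqP => Y0; apply: (@int_coprime_0_2 k) => //; rewrite -Y0.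
have Eb : beta ^+ 2 = alpha by rewrite sqrtCK.
have Eb' : beta' ^+ 2 = nu alpha by rewrite sqrtCK.
have al0 := alpha_neq0.
have al'0 : nu alpha != 0 by rewrite fmorph_eq0.
have b0 : beta != 0 by rewrite sqrtC_eq0.
have kal := alpha_in_k; have kal' := conj_Qadj nu_r1 kal.
have nuX := conj_ringint nu_r1 kX; have nuY := conj_ringint nu_r1 kY.
have nuZ := conj_ringint nu_r1 kZ.
have nuY0 : nu Y != 0 by rewrite fmorph_eq0.
have nuZ0 : nu Z != 0 by rewrite fmorph_eq0.
have nuE : nu X ^+ 2 - p3%:R * nu Y ^+ 2 - nu alpha * nu Z ^+ 2 = 0.
  rewrite -!rmorphXn -(rmorph_nat nu p3) -!(rmorphM nu) -!rmorphB.
  by rewrite E rmorph0.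
have nucop : int_coprime k [:: nu X; nu Y; nu Z].
  apply: (int_coprime_conj nu_r1 (s := [:: X; Y; Z])) => // w.
  by rewrite !inE => /or3P[] /eqP ->; [case: kX|case: kY|case: kZ].
have nucop2 : int_coprime k [:: nu Y; 2%:R].
  rewrite -(rmorph_nat nu 2).
  apply: (int_coprime_conj nu_r1 (s := [:: Y; 2%:R])) => // w.
  by rewrite !inE => /orP[] /eqP ->; [case: kY|exact: (subfield_nat sk)].
have Kgen w : w \in [:: r1; r2; r3; sqrtC ((X + Z * beta) * (X - Z * beta));
               sqrtC ((X + Z * beta) * (nu X + nu Z * beta'));
               sqrtC (X + Z * beta)] -> K w.
  by rewrite Kdef; exact: Qadj_mem.
have Kk w : ringint k w -> K w by move=> [kw _]; exact: kK.
(* [beta] is not among the generators; it is recovered from the last one, whose square is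
   [X + Z * beta]. *)
have Kb : K beta.
  have -> : beta = (sqrtC (X + Z * beta) ^+ 2 - X) / Z.
    by rewrite sqrtCK; field.
  apply: subfield_div => //; last exact: Kk.
  apply: subfieldB => //; last exact: Kk.
  by apply: subfieldX => //; apply: Kgen; rewrite !inE eqxx !orbT.
(* By the norm equation [beta * beta'] is [r2 * z] up to sign. *)
have b'_in (F : set algC) : subfield F -> F r2 -> F beta -> F beta'.
  move=> sF Fr2 Fb.
  have bb : beta * beta' = r2 * z%:~R \/ beta * beta' = - (r2 * z%:~R).
    apply: eq_or_oppr_sqr; rewrite exprMn Eb Eb' alpha_conj_mul.
    by rewrite exprMn sqrtCK.
  have -> : beta' = beta * beta' / beta by rewrite mulrAC divff ?mul1r.
  apply: (subfield_div sF) => //.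
  have Frz : F (r2 * z%:~R) by apply: (subfieldM sF) => //; exact: (subfield_int sF).
  by case: bb => ->; [|apply: (subfieldN sF)].
have Kb' : K beta' by exact: b'_in.
have E1 : X ^+ 2 - alpha * Z ^+ 2 = p3%:R * Y ^+ 2.
  by apply/eqP; rewrite -subr_eq0 addrAC E.
have E3 : nu X ^+ 2 - nu alpha * nu Z ^+ 2 = p3%:R * nu Y ^+ 2.
  by apply/eqP; rewrite -subr_eq0 addrAC nuE.
have theta12 : (X + Z * beta) * (X - Z * beta) = p3%:R * Y ^+ 2.
  by rewrite -E1 -Eb; ring.
have theta34 : (nu X + nu Z * beta') * (nu X - nu Z * beta') = p3%:R * nu Y ^+ 2.
  by rewrite -E3 -Eb'; ring.
have p30 : (p3%:R : algC) != 0 by rewrite pnatr_eq0 -lt0n prime_gt0.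
have [n1 n3] : X + Z * beta != 0 /\ nu X + nu Z * beta' != 0.
  have : (X + Z * beta) * (X - Z * beta) != 0 by rewrite theta12 mulf_neq0 ?expf_neq0.
  have : (nu X + nu Z * beta') * (nu X - nu Z * beta') != 0.
    by rewrite theta34 mulf_neq0 ?expf_neq0.
  by rewrite !mulf_eq0 !negb_or => /andP[-> _] /andP[-> _].
have n13 : (X + Z * beta) * (nu X + nu Z * beta') != 0 by exact: mulf_neq0.
have n12 : (X + Z * beta) * (X - Z * beta) != 0 by rewrite theta12 mulf_neq0 ?expf_neq0.
have mem (F : set algC) : subfield F -> F r2 -> F beta -> k `<=` F ->
    [/\ F (X + Z * beta), F ((X + Z * beta) * (X - Z * beta)) &
        F ((X + Z * beta) * (nu X + nu Z * beta'))].
  move=> sF Fr2 Fb kF; have Fb' := b'_in _ sF Fr2 Fb.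
  have Fk w : ringint k w -> F w by move=> [kw _]; exact: kF.
  have F1 : F (X + Z * beta).
    by apply: (subfieldD sF); [|apply: (subfieldM sF)] => //; exact: Fk.
  split=> //; apply: (subfieldM sF) => //.
    by apply: (subfieldB sF); [|apply: (subfieldM sF)] => //; exact: Fk.
  by apply: (subfieldD sF); [|apply: (subfieldM sF)] => //; exact: Fk.
pose t1 := sqrtC (X + Z * beta).
pose t13 := sqrtC ((X + Z * beta) * (nu X + nu Z * beta')).
pose t12 := sqrtC ((X + Z * beta) * (X - Z * beta)).
have Kt : [/\ K t1, K t12 & K t13].
  by split; apply: Kgen; rewrite !inE eqxx ?orbT.
have [Kt1 Kt12 Kt13] := Kt.
(* At [p3], the radicands lie in [Qadj [:: beta; r2; r1]], where [l] is still a uniformizer;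
   adjoining [r3] after that gives them even valuation. *)
have [lp3|lp3] := eqVneq l p3.
  have l2 : l != 2%N by rewrite lp3; exact: p_neq2.
  have lp2 : l != p2 by rewrite lp3 eq_sym.
  have -> : l \in [:: p1; p2; p3] by rewrite lp3 !inE eqxx !orbT.
  have dF : dvr_field K V M (Qadj [:: beta; r2; r1]) l%:R.
    have dk : dvr_field K V M k l%:R by apply: dvr_field_k_neq; rewrite lp3 eq_sym.
    have dr2 : dvr_field K V M (Qadj [:: r2; r1]) l%:R.
      exact: (dvr_field_sqrt_prime ld pl Ml).
    have sub : k `<=` Qadj [:: r2; r1].
      by apply: Qadj_sub; apply/allP; rewrite /= !inE !eqxx !orbT.
    apply: (dvr_field_unr ld pl Ml) => //; rewrite Eb; first exact: sub.
    by case: (unr_alpha (Qadj_subfield [:: r2; r1]) lp2).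
  have dS : dvr_field K V M (Qadj [:: r3; beta; r2; r1]) (sqrtC l%:R).
    by rewrite -lp3; apply: (dvr_field_sqrt_ram ld) => //; rewrite lp3.
  have sS := Qadj_subfield [:: r3; beta; r2; r1].
  have [|||m1 m12 m13] := mem _ (Qadj_subfield [:: beta; r2; r1]).
  - by apply: Qadj_mem; rewrite !inE eqxx orbT.
  - by apply: Qadj_mem; rewrite !inE eqxx.
  - by apply: Qadj_sub; apply/allP; rewrite /= !inE !eqxx !orbT.
  have sub : Qadj [:: beta; r2; r1] `<=` Qadj [:: r3; beta; r2; r1].
    by apply: Qadj_sub; apply/allP; rewrite /= !inE !eqxx !orbT.
  have sq a : Qadj [:: beta; r2; r1] a -> a != 0 ->
      unr V M l (Qadj [:: r3; beta; r2; r1]) a.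
    move=> Fa a0; apply: unr_sq_unit => //; apply: (sq_unit_root dF) => //.
    by apply: Qadj_mem; rewrite lp3 inE eqxx.
  have dK : dvr_field K V M (Qadj [:: t1; t13; t12; r3; beta; r2; r1]) (sqrtC l%:R).
    by apply: dvr_field_unr3 => //; first [exact: sub|exact: sq].
  apply: (uniformizer_sub dK); rewrite Kdef; apply: Qadj_sub; apply/allP.
  by rewrite /= !inE !eqxx !orbT.
pose S := [:: beta; r2; r3; r1].
have sS : subfield (Qadj S) by exact: Qadj_subfield.
have Sr2 : Qadj S r2 by apply: Qadj_mem; rewrite !inE eqxx !orbT.
have Sb : Qadj S beta by apply: Qadj_mem; rewrite !inE eqxx.
have kS : k `<=` Qadj S by apply: Qadj_sub; apply/allP; rewrite /= !inE !eqxx !orbT.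
have Sk w : ringint k w -> Qadj S w by move=> [kw _]; exact: kS.
have LS : L `<=` Qadj S by apply: Qadj_sub; apply/allP; rewrite /= !inE !eqxx !orbT.
have k2 : k `<=` Qadj [:: r2; r3; r1].
  by apply: Qadj_sub; apply/allP; rewrite /= !inE !eqxx !orbT.
have s2 := Qadj_subfield [:: r2; r3; r1].
have [m1 m12 m13] := mem _ sS Sr2 Sb kS.
suff [dS u1 u3] : [/\ dvr_field K V M (Qadj S) piL, unr V M l (Qadj S) (X + Z * beta) &
    unr V M l (Qadj S) (nu X + nu Z * beta')].
  have u12 : unr V M l (Qadj S) ((X + Z * beta) * (X - Z * beta)).
    rewrite theta12; apply: (unrM ld) => //; first exact: (unr_prime ld pl Ml).
    by apply: (unr_sqr ld) => //; [exact: Sk|move=> l2; exact: coprime2_lunit].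
  have u13 : unr V M l (Qadj S) ((X + Z * beta) * (nu X + nu Z * beta')).
    exact: (unrM ld).
  have dK : dvr_field K V M (Qadj [:: t1, t13, t12 & S]) piL by exact: dvr_field_unr3.
  apply: (uniformizer_sub dK); rewrite Kdef; apply: Qadj_sub; apply/allP.
  by rewrite /= !inE !eqxx !orbT.
(* At [p2], [alpha] has even valuation once [r2] is adjoined to [k13], so [beta] is harmless. The
   radicands involve [beta] and are not known to lie in [k13]; the parity argument with [rho = r2]
   replaces the direct one. *)
have [lp2|lp2] := eqVneq l p2.
  have l2 : l != 2%N by rewrite lp2; exact: p_neq2.
  have -> : l \in [:: p1; p2; p3] by rewrite lp2 !inE eqxx orbT.
  have dL : dvr_field K V M L l%:R.
    apply: (dvr_field_sqrt_prime ld pl Ml) => //.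
    by apply: dvr_field_k_neq; rewrite lp2 eq_sym.
  have d2 : dvr_field K V M (Qadj [:: r2; r3; r1]) (sqrtC l%:R).
    by rewrite -lp2; apply: (dvr_field_sqrt_ram ld) => //; rewrite lp2.
  have dS : dvr_field K V M (Qadj S) (sqrtC l%:R).
    apply: (dvr_field_unr ld pl Ml) => //; rewrite Eb; first exact: k2.
    apply: unr_sq_unit => //; apply: (sq_unit_root dL) => //; last exact: kL.
    by apply: Qadj_mem; rewrite lp2 inE eqxx.
  have Up3 : U p3%:R by exact: (lunit_prime ld pl Ml).
  have Lk w : ringint k w -> L w by move=> [kw _]; exact: kL.
  have dL' : dvr_field K V M L (r2 ^+ 2) by rewrite sqrtCK -lp2.
  have Lr2 : L (r2 ^+ 2) by rewrite sqrtCK; exact: (subfield_nat sL).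
  split=> //; apply: unr_sq_unit => //.
    apply: (sq_unit_sqrt_theta ld pl Ml l2 dL' Lr2 sS LS Sr2) Eb Kb Up3 Y0 Z0 E1 => //;
      by [exact: Lk|exact: kL].
  apply: (sq_unit_sqrt_theta ld pl Ml l2 dL' Lr2 sS LS Sr2) Eb' Kb' Up3 nuY0 nuZ0 E3 => //;
    by [exact: Lk|exact: kL].
have [Ua Ua'] := alpha_lunit lp2.
(* [nu beta] is a square root of [nu alpha], hence [beta'] up to sign, which lies in [Qadj S]. *)
have nuS w : Qadj [:: r1; beta] w -> Qadj S (nu w).
  apply: (@Qadj_min _ [set w | Qadj S (nu w)]); first exact: preim_subfield.
  move=> v; rewrite !inE => /orP[] /eqP -> /=.
    by rewrite nu_r1; apply: (subfieldN sS); exact: kS.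
  have [|->|->] := @eq_or_oppr_sqr (nu beta) beta'.
  - by rewrite -rmorphXn Eb Eb'.
  - exact: (b'_in _ sS).
  - by apply: (subfieldN sS); exact: (b'_in _ sS).
have SK : Qadj S `<=` K.
  apply: Qadj_min => // w; rewrite !inE => /or4P[] /eqP -> //.
have subS : Qadj [:: r1; beta] `<=` Qadj S.
  by apply: Qadj_sub; apply/allP; rewrite /= !inE !eqxx !orbT.
split.
- apply: (dvr_field_unr ld pl Ml) => //; rewrite ?Eb; [|exact: k2|].
    apply: (dvr_field_sqrt_prime ld pl Ml) => //; exact: dvr_field_k13.
  by case: (unr_alpha s2 lp2).
- apply: (unr_theta_sqrt_alpha sS (Sk _ kY) lp3 kX kY kZ Y0 Kb Eb Ua E cop).
    by move=> l2; exact: coprime2_lunit.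
  move=> _; left; apply: (sq_mod4_cong (mu := idfun) _ Llam lamE) => w /= Lw.
  by have := subS _ Lw => Lw'; split=> //; exact: SK.
- apply: (unr_theta_sqrt_alpha sS (Sk _ nuY) lp3 nuX nuY nuZ nuY0 Kb' Eb' Ua' nuE nucop).
    by move=> l2; exact: coprime2_lunit.
  move=> _; have := @sq_mod4_cong _ (Qadj S) nu _ _ _ Llam lamE.
  rewrite rmorphD rmorphM /=.
  have [|->|->] := @eq_or_oppr_sqr (nu beta) beta'.
  - by rewrite -rmorphXn Eb Eb'.
  - by move=> H; left; apply: H => w /nuS Lw; split=> //; exact: SK.
  - by rewrite mulrN => H; right; apply: H => w /nuS Lw; split=> //; exact: SK.
Qed.

End Place.

(** * Nonvanishing of [Z] and assembly of the theorem *)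

(** At a prime above [q], [q] is still a uniformizer of the quadratic field, so for nonzero [Y] the
    valuation of [X ^+ 2] is even and that of [q * Y ^+ 2] odd. *)
Lemma prime_not_sqr_quadratic p q X Y : prime p -> prime q -> q != p ->
  (p = 1 %[mod 4])%N -> Qadj [:: sqrtC p%:R] X -> Qadj [:: sqrtC p%:R] Y ->
  X ^+ 2 = q%:R * Y ^+ 2 -> Y = 0.
Proof.
move=> pp pq qp p4; set k := Qadj _ => kX kY E.
have sk : subfield k by exact: Qadj_subfield.
have [P [pP Pq]] := prime_over_exists sk pq.
have ld := loc_local_domain sk pP; have Mq := prime_locmax sk pP Pq.
have [_ _ [_ q0 HF]] : dvr_field k (loc k P) (locmax k P) k q%:R.
  apply: (dvr_field_sqrt_prime ld pq Mq) => //; first exact: (dvr_field_base ld).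
  by apply: Qadj_mem; rewrite inE.
have [//|Y0] := eqVneq Y 0.
have X0 : X != 0.
  apply: contra_neq Y0 => X0; apply/eqP; move/eqP: E.
  by rewrite X0 expr0n eq_sym mulf_eq0 (negPf q0) expf_eq0.
have [i [u [Uu EX]]] := HF _ kX X0; have [j [v [Uv EY]]] := HF _ kY Y0.
have : q%:R ^ (i + i) * u ^+ 2 = q%:R ^ (1 + j + j) * v ^+ 2.
  have -> : q%:R ^ (i + i) * u ^+ 2 = X ^+ 2 by rewrite EX expfzDr //; ring.
  by rewrite E EY !expfzDr // expr1z; ring.
have Usq w : lunit (loc k P) (locmax k P) w -> lunit (loc k P) (locmax k P) (w ^+ 2).
  by move=> Uw; rewrite expr2; exact: (lunitM ld).
by move/(exprz_unit_inj ld Mq q0 (Usq _ Uu) (Usq _ Uv)); lia.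
Qed.

Lemma legendre1_neq p q : prime q -> legendre p q = 1 -> p != q.
Proof. by move=> pq; rewrite /legendre; case: ifP => // /negbT nd _; apply: contra nd => /eqP ->. Qed.

Theorem theorem3p1p10 (p1 p2 p3 : nat) (x y z : int) (m : nat)
    (P2 : set algC) (X Y Z X' Y' Z' alpha' : algC) (K : set algC) :
  let r1 : algC := sqrtC p1%:R in
  let r2 : algC := sqrtC p2%:R in
  let r3 : algC := sqrtC p3%:R in
  let k := Qadj [:: r1] in
  let k13 := Qadj [:: r1; r3] in
  let alpha := redei_elt p1 x y in
  let k13' := Qadj [:: r1; sqrtC alpha] in
  let theta1 := X + Y * r3 in
  let theta2 := X - Y * r3 in
  let theta3 := X' + Y' * r3 in
  let theta1' := X + Z * sqrtC alpha in
  let theta2' := X - Z * sqrtC alpha in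
  let theta3' := X' + Z' * sqrtC alpha' in
  (forall p, p \in [:: p1; p2; p3] -> prime p /\ (p = 1 %[mod 4])%N) ->
  (forall q1 q2 q3, perm_eq [:: q1; q2; q3] [:: p1; p2; p3] ->
     legendre q1 q2 = 1 /\ redei_symbol q1 q2 q3 1) ->
  (p1 = 5 %[mod 8])%N ->
  class_number k 1 ->
  prime_over k p2 P2 ->
  redei_solution p1 p2 x y z ->
  odd m -> principal k alpha = idpow k P2 m ->
  ringint k X -> ringint k Y -> ringint k Z ->
  X ^+ 2 - p3%:R * Y ^+ 2 - alpha * Z ^+ 2 = 0 ->
  int_coprime k [:: X; Y; Z] ->
  (int_coprime k [:: Z; 2%:R] /\
     (exists2 lam, ringint k13 lam & int_cong k13 4%:R (lam ^+ 2) theta1)) \/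
  (int_coprime k [:: Y; 2%:R] /\
     (exists2 lam, ringint k13' lam & int_cong k13' 4%:R (lam ^+ 2) theta1')) ->
  quad_conj p1 X X' -> quad_conj p1 Y Y' -> quad_conj p1 Z Z' ->
  quad_conj p1 alpha alpha' ->
  (int_coprime k [:: Z; 2%:R] ->
     K = Qadj [:: r1; r2; r3; sqrtC (theta1 * theta2);
                  sqrtC (theta1 * theta3); sqrtC theta1]) ->
  (int_coprime k [:: Y; 2%:R] ->
     K = Qadj [:: r1; r2; r3; sqrtC (theta1' * theta2');
                  sqrtC (theta1' * theta3'); sqrtC theta1']) ->
  (forall l : nat, prime l -> (ramified K l <-> l \in [:: p1; p2; p3])) /\
  (forall l : nat, l \in [:: p1; p2; p3] ->
     forall P, prime_over K l P -> ram_index K l P 2).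
Proof.
move=> r1 r2 r3 k k13 alpha k13' theta1 theta2 theta3 theta1' theta2' theta3'.
move=> Hp Hleg _ cn [_ P2p2] sol _ alphaE kX kY kZ E cop cases cX cY cZ cal KA KB.
have [pp1 p14] : prime p1 /\ (p1 = 1 %[mod 4])%N by apply: Hp; rewrite !inE eqxx.
have [pp2 p24] : prime p2 /\ (p2 = 1 %[mod 4])%N by apply: Hp; rewrite !inE eqxx orbT.
have [pp3 p34] : prime p3 /\ (p3 = 1 %[mod 4])%N by apply: Hp; rewrite !inE eqxx !orbT.
(* The three primes are distinct because the Legendre symbol of a prime over itself is 0, not 1. *)
have p12 : p1 != p2.
  by apply: legendre1_neq => //; case: (Hleg p1 p2 p3 (perm_refl _)).
have p13 : p1 != p3.
  apply: legendre1_neq => //; case: (Hleg p1 p3 p2) => //.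
  by rewrite perm_cons (perm_catC [:: p3] [:: p2]).
have p23 : p2 != p3.
  apply: legendre1_neq => //; case: (Hleg p2 p3 p1) => //.
  by rewrite (perm_catC [:: p2; p3] [:: p1]).
have [nu nu_r1] := sqrtC_prime_conj pp1.
have EX' := quad_conjE nu_r1 cX; have EY' := quad_conjE nu_r1 cY.
have EZ' := quad_conjE nu_r1 cZ; have Eal' := quad_conjE nu_r1 cal.
have sk : subfield k by exact: Qadj_subfield.
(* As [p2] lies in [P2], its [m]-th power lies in that of [P2], the ideal generated by [alpha]. *)
have alpha_dvd : int_dvd k alpha (p2%:R ^+ m).
  suff : idpow k P2 m (p2%:R ^+ m).
    by rewrite -alphaE => -[w kw <-]; exists w.
  elim: m {alphaE} => [|n IH] /=; first exact: ringint1.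
  exists 1%N, (fun=> p2%:R), (fun=> p2%:R ^+ n); split=> //.
  by rewrite big_ord1 exprS.
(* If [Z] were 0, then [X ^+ 2 = p3 * Y ^+ 2] would force [Y = 0], which is not prime to 2. *)
have Z0 : int_coprime k [:: Y; 2%:R] -> Z != 0.
  move=> cop2; apply/eqP => Z0; apply: (int_coprime_0_2 _ sk).
  rewrite -(prime_not_sqr_quadratic pp1 pp3 _ p14 (proj1 kX) (proj1 kY)) //.
    by rewrite eq_sym.
  by apply/eqP; rewrite -subr_eq0; move/eqP: E; rewrite Z0 expr0n mulr0 subr0.
have [g [Kg sub]] : exists g, K = Qadj g /\ {subset [:: r1; r2; r3] <= g}.
  case: cases => [[/KA -> _]|[/KB -> _]]; eexists; (split; first by []);
    by apply/allP; rewrite /= !inE !eqxx !orbT.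
have sK : subfield K by rewrite Kg; exact: Qadj_subfield.
have Kr i : i \in [:: r1; r2; r3] -> K i by move=> /sub ig; rewrite Kg; exact: Qadj_mem.
have Kr1 : K r1 by apply: Kr; rewrite !inE eqxx.
have Kr2 : K r2 by apply: Kr; rewrite !inE eqxx orbT.
have Kr3 : K r3 by apply: Kr; rewrite !inE eqxx !orbT.
apply: ramification_of_uniformizers => //.
  by move=> p; rewrite !inE => /or3P[] /eqP ->.
move=> l P pl ovP; case: cases => [[cop2 [lam Llam lamE]]|[cop2 [lam Llam lamE]]].
  have Kdef := KA cop2; rewrite /theta3 EX' EY' in Kdef.
  exact: (uniformizer_theta pp1 pp2 pp3 p14 p24 p34 p12 p13 p23 nu_r1 cn sol
    alpha_dvd sK Kr1 Kr2 Kr3 pl ovP kX kY kZ E cop cop2 Llam lamE Kdef).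
have Kdef := KB cop2; rewrite /theta3' EX' EZ' Eal' in Kdef.
exact: (uniformizer_theta' pp1 pp2 pp3 p14 p24 p34 p12 p13 p23 nu_r1 cn sol
  alpha_dvd sK Kr1 Kr2 Kr3 pl ovP kX kY kZ (Z0 cop2) E cop cop2 Llam lamE Kdef).
Qed.
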